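(* Let $k$ be an algebraically closed field of characteristic zero, let $2\le n<d$ and $0\le\alpha_0\le\cdots\le\alpha_n<d$ be integers with $\mathrm{GCD}(\alpha_0,\ldots,\alpha_n,d)=1$, and let $e\in k$ be a primitive $d$th root of unity. Let $\Lambda\subset GL(n+1,k)$ be the cyclic group of order $d$ generated by $\mathrm{diag}(e^{\alpha_0},\ldots,e^{\alpha_n})$, let $\{m_1,\ldots,m_{\mu_d}\}$ be the set of all monomials of degree $d$ in $R=k[x_0,\ldots,x_n]$ which are invariants of $\Lambda$, let $\varphi_{I_d}:\mathbb{P}^n\to\mathbb{P}^{\mu_d-1}$ be the morphism defined by $(m_1,\ldots,m_{\mu_d})$, and let $X_d=\varphi_{I_d}(\mathbb{P}^n)$. Then $X_d$ is a toric arithmetically Cohen-Macaulay variety.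
   Context: A diagonal matrix $\mathrm{diag}(c_0,\ldots,c_n)$ acts on $R$ by $x_i\mapsto c_i x_i$. The map $\varphi_{I_d}$ is a morphism because $x_0^d,\ldots,x_n^d$ are among the $m_i$. ''Toric'' is meant in the sense of a projective variety parameterized by monomials. A projective variety $X\subset\mathbb{P}^{N}$ is arithmetically Cohen-Macaulay (aCM) if its homogeneous coordinate ring $k[w_1,\ldots,w_{N+1}]/I(X)$ is a Cohen-Macaulay ring, where $I(X)$ is the homogeneous ideal of $X$. *)

(* Defs.v *)
From HB Require Import structures.
From mathcomp Require Import all_boot all_order all_algebra.
From mathcomp Require Import boolp classical_sets.
From mathcomp Require Import mpoly.
From mathcomp Require Import ring.

Set Implicit Arguments.
Unset Strict Implicit.
Unset Printing Implicit Defensive.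

Import GRing.Theory.
Local Open Scope ring_scope.
Local Open Scope quotient_scope.
Local Open Scope classical_set_scope.

Section Ideals.
Variable R : comNzRingType.
Implicit Types (S : set R) (I J M : {pred R}).

Definition ideal_gen S : set R :=
  [set x | exists2 s : seq (R * R), (forall p, p \in s -> S p.2)
             & x = \sum_(p <- s) p.1 * p.2].

Definition seq_ideal (s : seq R) : set R := ideal_gen [set` s].

(* idealr_closed I says that I is a proper ideal, and R itself is (1). *)
Definition noetherian : Prop :=
  forall I, idealr_closed I -> exists s : seq R, [set` I] = seq_ideal s.

Definition prime_ideal (P : {pred R}) : Prop := idealr_closed P /\ prime_idealr_closed P.

Definition maximal_ideal M : Prop :=
  idealr_closed M /\
  forall J, idealr_closed J -> {subset M <= J} -> {subset J <= M}.

Definition prime_chain (r : nat) (P : nat -> {pred R}) : Prop :=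
  (forall i, (i <= r)%N -> prime_ideal (P i)) /\
  (forall i, (i < r)%N -> {subset P i <= P i.+1} /\ ~ {subset P i.+1 <= P i}).

Definition krull_dim_eq (r : nat) : Prop :=
  (exists P, prime_chain r P) /\
  (forall s, (exists P, prime_chain s P) -> (s <= r)%N).

Definition regular_seq (s : seq R) : Prop :=
  (forall i, (i < size s)%N -> forall a : R,
     seq_ideal (take i s) (s`_i * a) -> seq_ideal (take i s) a) /\
  ~ seq_ideal s 1.

Definition depth_eq M (r : nat) : Prop :=
  (exists s, [/\ {subset s <= M}, regular_seq s & size s = r]) /\
  (forall s, {subset s <= M} -> regular_seq s -> (size s <= r)%N).

Definition local_with M : Prop :=
  maximal_ideal M /\ forall J, maximal_ideal J -> J =i M.

Definition CM_local : Prop :=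
  noetherian /\ exists M, local_with M /\
    exists r, depth_eq M r /\ krull_dim_eq r.

Lemma ideal_gen_sub S x : S x -> ideal_gen S x.
Proof.
move=> Sx; exists [:: (1, x)]; last by rewrite big_seq1 mul1r.
by move=> p; rewrite inE => /eqP ->.
Qed.

Lemma ideal_gen0 S : ideal_gen S 0.
Proof. by exists [::]; rewrite ?big_nil. Qed.

Lemma ideal_genD S x y : ideal_gen S x -> ideal_gen S y -> ideal_gen S (x + y).
Proof.
move=> [s hs ->] [t ht ->]; exists (s ++ t); last by rewrite big_cat.
by move=> p; rewrite mem_cat => /orP[/hs|/ht].
Qed.

Lemma ideal_genM S a x : ideal_gen S x -> ideal_gen S (a * x).
Proof.
move=> [s hs ->]; exists [seq (a * p.1, p.2) | p <- s].
  by move=> _ /mapP[q /hs Sq ->].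
by rewrite big_map mulr_sumr; apply: eq_bigr => p _; rewrite mulrA.
Qed.

Lemma maximal_ideal_prime M : maximal_ideal M -> prime_ideal M.
Proof.
move=> [[M0 M1 MD] Mmax]; split=> // u v uvM; apply/orP.
case: (boolP (u \in M)) => uM; [by left | right].
have MA a x : x \in M -> a * x \in M.
  by move=> xM; rewrite -[a * x]addr0 MD.
have MS x y : x \in M -> y \in M -> x + y \in M.
  by move=> xM yM; rewrite -[x]mul1r MD.
pose J : {pred R} := fun x => `[< exists a m, m \in M /\ x = a * u + m >].
have JE x : (x \in J) = `[< exists a m, m \in M /\ x = a * u + m >] by [].
have [J1|J1] := boolP (1 \in J).
  move: J1; rewrite JE => /asboolP[a [m [mM e1]]].
  rewrite -[v]mul1r e1 mulrDl -mulrA; apply: MS; first exact: MA.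
  by rewrite mulrC MA.
case/negP: uM; apply: (Mmax J).
- split=> //.
    by rewrite JE; apply/asboolP; exists 0, 0; rewrite mul0r addr0.
  move=> a x y; rewrite !JE => /asboolP[b [m [mM ->]]] /asboolP[c [m' [m'M ->]]].
  apply/asboolP; exists (a * b + c), (a * m + m'); split; first exact: MD.
  by rewrite mulrDr mulrDl !mulrA addrACA.
- move=> x xM; rewrite JE; apply/asboolP; exists 0, x.
  by rewrite mul0r add0r.
- by rewrite JE; apply/asboolP; exists 1, 0; rewrite mul1r addr0.
Qed.

End Ideals.

Module Loc.
Section Loc.
Variables (R : comNzRingType) (P : prime_idealr R).

(* den is the type of denominators, i.e. the complement of P. *)
Definition den := {s : R | s \notin (P : {pred R})}.

Lemma den1_subproof : 1 \notin (P : {pred R}).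
Proof. by rewrite idealr1. Qed.
Definition den1 : den := exist _ 1 den1_subproof.

Lemma denM_subproof (s t : den) : sval s * sval t \notin (P : {pred R}).
Proof. by rewrite prime_idealrM negb_or (svalP s) (svalP t). Qed.
Definition denM (s t : den) : den := exist _ (sval s * sval t) (denM_subproof s t).

Definition frac := (R * den)%type.

Definition equiv (x y : frac) : bool :=
  `[< exists t : den, sval t * (x.1 * sval y.2) = sval t * (y.1 * sval x.2) >].

Lemma equiv_is_equiv : equiv_class_of equiv.
Proof.
split=> [x|x y|y x z].
- by apply/asboolP; exists den1.
- by apply/asboolP/asboolP => -[t ht]; exists t.
- move=> /asboolP[t ht] /asboolP[u hu]; apply/asboolP.
  exists (denM (denM t u) y.2) => /=.
  transitivity (sval u * sval z.2 * (sval t * (x.1 * sval y.2))); first by ring.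
  rewrite ht.
  transitivity (sval t * sval x.2 * (sval u * (y.1 * sval z.2))); first by ring.
  by rewrite hu; ring.
Qed.

Canonical equiv_equivRel := EquivRelPack equiv_is_equiv.
Canonical equiv_encModRel := defaultEncModRel equiv.

Definition loc := {eq_quot equiv}.

#[export] HB.instance Definition _ : EqQuotient frac equiv loc := EqQuotient.on loc.
#[export] HB.instance Definition _ := Choice.on loc.

Definition mk (a : R) (s : den) : loc := \pi_loc (a, s).

Lemma mkE a s b t :
  mk a s = mk b t <-> exists u : den, sval u * (a * sval t) = sval u * (b * sval s).
Proof.
split; first by move/eqP; rewrite /mk piE => /asboolP.
by move=> h; apply/eqP; rewrite /mk piE; apply/asboolP.
Qed.

Lemma mkP (x : loc) : {as_ : R * den | x = mk as_.1 as_.2}.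
Proof. by exists (repr x); rewrite /mk -surjective_pairing reprK. Qed.

Definition zero : loc := mk 0 den1.
Definition one : loc := mk 1 den1.
Definition opp (x : loc) : loc := mk (- (repr x).1) (repr x).2.
Definition add (x y : loc) : loc :=
  mk ((repr x).1 * sval (repr y).2 + (repr y).1 * sval (repr x).2)
     (denM (repr x).2 (repr y).2).
Definition mul (x y : loc) : loc :=
  mk ((repr x).1 * (repr y).1) (denM (repr x).2 (repr y).2).

Lemma repr_mk a s : exists u : den,
  sval u * ((repr (mk a s)).1 * sval s) = sval u * (a * sval (repr (mk a s)).2).
Proof. by apply/mkE; rewrite /mk -surjective_pairing reprK. Qed.

Lemma oppE a s : opp (mk a s) = mk (- a) s.
Proof.
have [u hu] := repr_mk a s; apply/mkE; exists u.
by rewrite !mulNr !mulrN hu.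
Qed.

Lemma addE a s b t : add (mk a s) (mk b t) = mk (a * sval t + b * sval s) (denM s t).
Proof.
have [u hu] := repr_mk a s; have [v hv] := repr_mk b t.
apply/mkE; exists (denM u v) => /=.
move: (repr (mk a s)) (repr (mk b t)) hu hv => [a' s'] [b' t'] /= hu hv.
transitivity (sval u * (a' * sval s) * (sval v * sval t * sval t')
  + sval v * (b' * sval t) * (sval u * sval s * sval s')); first by ring.
by rewrite hu hv; ring.
Qed.

Lemma mulE a s b t : mul (mk a s) (mk b t) = mk (a * b) (denM s t).
Proof.
have [u hu] := repr_mk a s; have [v hv] := repr_mk b t.
apply/mkE; exists (denM u v) => /=.
move: (repr (mk a s)) (repr (mk b t)) hu hv => [a' s'] [b' t'] /= hu hv.
transitivity (sval u * (a' * sval s) * (sval v * (b' * sval t))); first by ring.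
by rewrite hu hv; ring.
Qed.

Lemma addA : associative add.
Proof.
move=> x y z; case: (mkP x) (mkP y) (mkP z) => [x' ->] [y' ->] [z' ->].
by rewrite !addE; apply/mkE; exists den1 => /=; ring.
Qed.

Lemma addC : commutative add.
Proof.
move=> x y; case: (mkP x) (mkP y) => [x' ->] [y' ->].
by rewrite !addE; apply/mkE; exists den1 => /=; ring.
Qed.

Lemma add0 : left_id zero add.
Proof.
move=> x; case: (mkP x) => [x' ->].
by rewrite addE; apply/mkE; exists den1 => /=; ring.
Qed.

Lemma addN : left_inverse zero opp add.
Proof.
move=> x; case: (mkP x) => [x' ->].
by rewrite oppE addE; apply/mkE; exists den1 => /=; ring.
Qed.

#[export] HB.instance Definition _ := GRing.isZmodule.Build loc addA addC add0 addN.

Lemma mulA : associative mul.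
Proof.
move=> x y z; case: (mkP x) (mkP y) (mkP z) => [x' ->] [y' ->] [z' ->].
by rewrite !mulE; apply/mkE; exists den1 => /=; ring.
Qed.

Lemma mulC : commutative mul.
Proof.
move=> x y; case: (mkP x) (mkP y) => [x' ->] [y' ->].
by rewrite !mulE; apply/mkE; exists den1 => /=; ring.
Qed.

Lemma mul1 : left_id one mul.
Proof.
move=> x; case: (mkP x) => [x' ->].
by rewrite mulE; apply/mkE; exists den1 => /=; ring.
Qed.

Lemma mulD : left_distributive mul add.
Proof.
move=> x y z; case: (mkP x) (mkP y) (mkP z) => [x' ->] [y' ->] [z' ->].
by rewrite !(addE, mulE); apply/mkE; exists den1 => /=; ring.
Qed.

Lemma one_neq0 : one != zero.
Proof.
apply/eqP => /mkE[u] /=; rewrite mul0r mulr0 !mulr1 => u0.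
by have := svalP u; rewrite u0 idealr0.
Qed.

#[export] HB.instance Definition _ :=
  GRing.Zmodule_isComNzRing.Build loc mulA mulC mul1 mulD one_neq0.

End Loc.
Module Exports. HB.reexport. End Exports.
End Loc.
Export Loc.Exports.

Notation loc := Loc.loc.

(* By maximal_ideal_prime, every maximal ideal is a prime_idealr. *)
Definition cohen_macaulay (R : comNzRingType) : Prop :=
  noetherian R /\
  forall P : prime_idealr R, maximal_ideal P -> CM_local (loc P).

(* proj k N is the projective space with N homogeneous coordinates (so of
   dimension N - 1): the lines through the origin in k^N. *)
Definition proj (k : fieldType) (N : nat) :=
  {L : {vspace 'rV[k]_N} | \dim L == 1%N}.

Section Projective.
Variables (k : fieldType) (N : nat).
Implicit Types (p : proj k N) (f : {mpoly k[N]}) (X Y Z : set (proj k N)).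

Lemma point_subproof (v : 'rV[k]_N) : v != 0 -> \dim <[v]>%VS == 1%N.
Proof. by rewrite dim_vline => ->. Qed.

Definition point (v : 'rV[k]_N) (v0 : v != 0) : proj k N :=
  exist _ <[v]>%VS (point_subproof v0).

Definition coords p : 'rV[k]_N := vpick (val p).

Lemma coords_neq0 p : coords p != 0.
Proof. by rewrite vpick0 -dimv_eq0 (eqP (valP p)). Qed.

Definition meval_row f (v : 'rV[k]_N) : k := f.@[fun i => v 0 i].

Definition homogeneous f : Prop := exists e : nat, f \is e.-homog.

Definition vanishes f p : Prop :=
  forall v, v \in val p -> v != 0 -> meval_row f v = 0.

Definition zero_locus (T : set {mpoly k[N]}) : set (proj k N) :=
  [set p | forall f, T f -> vanishes f p].

Definition zariski_closed X : Prop :=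
  exists2 T, T `<=` homogeneous & X = zero_locus T.

Definition zariski_closure X : set (proj k N) :=
  [set p | forall Z, zariski_closed Z -> X `<=` Z -> Z p].

Definition zariski_irreducible X : Prop :=
  X !=set0 /\
  forall Y Z, zariski_closed Y -> zariski_closed Z ->
    X `<=` Y `|` Z -> X `<=` Y \/ X `<=` Z.

Definition projective_variety X : Prop :=
  zariski_closed X /\ zariski_irreducible X.

(* Exponents are natural numbers; this is no loss with respect to Laurent
   monomials, as multiplying all the coordinates by a common monomial does not
   change the point. Toric varieties are not required to be normal. *)
Definition monomial_torus_image (s : nat) (a : 'I_N -> 'X_{1..s}) :
    set (proj k N) :=
  [set p | exists t : 'I_s -> k, (forall j, t j != 0) /\
     val p = <[\row_i ('X_[a i] : {mpoly k[s]}).@[t]]>%VS].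

Definition toric_variety X : Prop :=
  projective_variety X /\
  exists (s : nat) (a : 'I_N -> 'X_{1..s}),
    X = zariski_closure (monomial_torus_image a).

Definition vanishing_ideal X : {pred {mpoly k[N]}} :=
  fun f => `[< ideal_gen
    [set g | homogeneous g /\ forall p, X p -> vanishes g p] f >].

Lemma vanishing_ideal_closed X : X !=set0 -> idealr_closed (vanishing_ideal X).
Proof.
move=> [p Xp]; split.
- by apply/asboolP; apply: ideal_gen0.
- apply/negP => /asboolP[s hs /(congr1 (fun f => meval_row f (coords p)))].
  rewrite /meval_row meval1 raddf_sum big_seq big1 => [/eqP|q qs].
    by rewrite oner_eq0.
  have [_ /(_ p Xp (coords p) (memv_pick _) (coords_neq0 p)) q0] := hs _ qs.
  by rewrite /= mevalM [X in _ * X]q0 mulr0.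
- move=> a f g /asboolP fX /asboolP gX; apply/asboolP.
  by apply: ideal_genD => //; apply: ideal_genM.
Qed.

Section CoordinateRing.
Variables (X : set (proj k N)) (X0 : X !=set0).

(* X0 is a parameter because library ideals are proper. *)
Definition vanishing_idealr of X !=set0 : {mpoly k[N]} -> bool :=
  vanishing_ideal X.

HB.instance Definition _ := isIdealr.Build {mpoly k[N]} (vanishing_idealr X0)
  (vanishing_ideal_closed X0).

Definition homogeneous_coordinate_ring := 
  Quotient.quot (vanishing_idealr X0 : idealr {mpoly k[N]}).

HB.instance Definition _ := GRing.ComNzRing.on homogeneous_coordinate_ring.

End CoordinateRing.

Definition arithmetically_CM X : Prop :=
  exists X0 : X !=set0, cohen_macaulay (homogeneous_coordinate_ring X0).

End Projective.

(* The map from proj k n to proj k mu defined by mu forms without common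
   zeros, evaluated at the representative coords p; by proj_mapE the choice
   of representative is irrelevant when the forms have the same degree. *)
Section ProjMap.
Variables (k : fieldType) (n mu : nat) (f : mu.-tuple {mpoly k[n]}).

Definition eval_forms (v : 'rV[k]_n) : 'rV[k]_mu :=
  \row_i meval_row (tnth f i) v.

Definition base_point_free : Prop := forall v, v != 0 -> eval_forms v != 0.

Hypothesis bpf : base_point_free.

Definition proj_map (p : proj k n) : proj k mu := point (bpf (coords_neq0 p)).

Lemma proj_mapE d (v : 'rV[k]_n) (v0 : v != 0) :
  (forall i, tnth f i \is d.-homog) -> proj_map (point v0) = point (bpf v0).
Proof.
move=> homf; apply/val_inj => /=.
have: coords (point v0) \in <[v]>%VS by exact: memv_pick.
case/vlineP => c cE; rewrite cE.
have c0 : c != 0.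
  by apply: contraNneq (coords_neq0 (point v0)) => c0; rewrite cE c0 scale0r.
have -> : eval_forms (c *: v) = c ^+ d *: eval_forms v.
  apply/rowP => i; rewrite !mxE /meval_row !mevalE mulr_sumr.
  apply: eq_big_seq => m mf; rewrite mulrCA; congr (_ * _).
  rewrite -(dhomog_mf (homf i) mf) /= mdegE -prodrXr -big_split /=.
  by apply: eq_bigr => j _; rewrite mxE exprMn.
apply/eqP; rewrite eqEsubv -!memvE memvZ ?memv_line //=.
have cd0 : c ^+ d != 0 by rewrite expf_neq0.
rewrite -{1}[eval_forms v]scale1r -(mulVf cd0) -scalerA.
by rewrite memvZ ?memv_line.
Qed.

End ProjMap.

Section Invariants.
Variables (k : fieldType) (n : nat).
Implicit Types (A : 'M[k]_n.+1) (p : {mpoly k[n.+1]}) (G : set 'M[k]_n.+1).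

(* For A = diag(c_0, ..., c_n) this is the substitution x_i |-> c_i x_i. *)
Definition mx_act A p : {mpoly k[n.+1]} :=
  p \mPo [tuple \sum_j A i j *: 'X_j | i < n.+1].

Definition invariant G p : Prop := forall A, G A -> mx_act A p = p.

Definition cyclic_subgroup A : set 'M[k]_n.+1 := [set A ^ j | j in [set: int]].

Definition diag_group (alpha : 'I_n.+1 -> nat) (e : k) : set 'M[k]_n.+1 :=
  cyclic_subgroup (diag_mx (\row_i e ^+ alpha i)).

Definition monomial_of_degree d p : Prop :=
  exists2 a : 'X_{1..n.+1}, p = 'X_[a] & mdeg a = d.

(* m is any ordering, without repetition, of the invariant monomials. *)
Definition lists_invariant_monomials d G mu (m : mu.-tuple {mpoly k[n.+1]}) :=
  uniq m /\ forall p, p \in m <-> (monomial_of_degree d p /\ invariant G p).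

Lemma mx_act_diag (c : 'rV[k]_n.+1) i : mx_act (diag_mx c) 'X_i = c 0 i *: 'X_i.
Proof.
rewrite /mx_act comp_mpolyXU -tnth_nth tnth_mktuple (bigD1 i) //=.
rewrite mxE eqxx big1 ?addr0 // => j ji.
by rewrite mxE eq_sym (negPf ji) scale0r.
Qed.

Lemma diag_mx_inv (c : 'rV[k]_n.+1) : (forall i, c 0 i != 0) ->
  (diag_mx c)^-1 = diag_mx (\row_i (c 0 i)^-1).
Proof.
move=> c0.
have cV : diag_mx (\row_i (c 0 i)^-1) * diag_mx c = 1.
  rewrite -[_ * _]/(_ *m _) mulmx_diag -[1]diag_const_mx.
  by congr diag_mx; apply/rowP => i; rewrite !mxE mulVf.
have [cU _] := mulmx1_unit cV.
have /(mulmx1_unit)[_ {}cU] := cV.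
by apply: (mulIr (x := diag_mx c)) => //; rewrite mulVr.
Qed.

Lemma diag_mx_expz (c : 'rV[k]_n.+1) (j : int) : (forall i, c 0 i != 0) ->
  diag_mx c ^ j = diag_mx (\row_i c 0 i ^ j).
Proof.
move=> c0.
have cX (r : nat) : diag_mx c ^+ r = diag_mx (\row_i c 0 i ^+ r).
  elim: r => [|r IH].
    rewrite expr0 -[1]diag_const_mx.
    by congr diag_mx; apply/rowP => i; rewrite !mxE expr0.
  rewrite exprS IH -[_ * _]/(_ *m _) mulmx_diag.
  by congr diag_mx; apply/rowP => i; rewrite !mxE exprS.
case: j => r; first by rewrite -exprnP cX.
rewrite NegzE -exprnN cX diag_mx_inv => [|i]; last by rewrite mxE expf_neq0.
by congr diag_mx; apply/rowP => i; rewrite !mxE -exprnN.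
Qed.

Lemma invariant_monomials_bpf d alpha e mu (m : mu.-tuple {mpoly k[n.+1]}) :
  d.-primitive_root e ->
  lists_invariant_monomials d (diag_group alpha e) m -> base_point_free m.
Proof.
move=> he [_ mE] v v0.
have ed : e ^+ d = 1 by exact: prim_expr_order he.
have e0 : e != 0.
  apply: contraTneq (oner_neq0 k) => e0; rewrite -ed e0 expr0n.
  by rewrite eqn0Ngt (prim_order_gt0 he) eqxx.
have [i vi] : exists i, v 0 i != 0.
  apply/existsP; apply: contra_neqT v0 => /existsPn v0.
  by apply/rowP => i; rewrite mxE; apply/eqP; have := v0 i; rewrite negbK.
have: 'X_i ^+ d \in m.
  apply/mE; split.
    exists (U_(i) *+ d)%MM; first by rewrite mpolyXn.
    by rewrite mdegMn mdeg1 mul1n.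
  move=> _ [j _ <-]; rewrite diag_mx_expz => [|l]; last by rewrite mxE expf_neq0.
  have := mx_act_diag (\row_l (\row_l0 e ^+ alpha l0) 0 l ^ j) i.
  rewrite /mx_act rmorphXn /= => ->; rewrite !mxE exprZn.
  suff -> : ((e ^+ alpha i) ^ j) ^+ d = 1 by rewrite scale1r.
  by rewrite exprnP exprzAC -exprnP -exprM mulnC exprM ed expr1n exp1rz.
case/tnthP => l ml; apply: contraNneq (expf_neq0 d vi) => /rowP/(_ l).
by rewrite !mxE -ml /meval_row rmorphXn /= mevalXU => ->.
Qed.

End Invariants.

Definition invariant_variety (k : fieldType) (n d mu : nat)
    (alpha : 'I_n.+1 -> nat) (e : k) (m : mu.-tuple {mpoly k[n.+1]})
    (he : d.-primitive_root e)
    (hm : lists_invariant_monomials d (diag_group alpha e) m) :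
    set (proj k mu) :=
  range (proj_map (invariant_monomials_bpf he hm)).

(* Main.v *)
Require Import Defs.
From HB Require Import structures.
From mathcomp Require Import all_boot all_order all_algebra all_field.
From mathcomp Require Import boolp classical_sets.
From mathcomp Require Import ssrcomplements mpoly ring zify.

(** Let [R] be the polynomial ring in [n.+1] variables. A monomial of degree [d]
    with exponent [a] is invariant exactly if [d] divides the weight
    [\sum_i alpha i * a i]. Call an exponent invariant if [d] divides its weight
    and its degree.

    Generation. Every monomial with invariant exponent is a product of invariant
    monomials of degree [d]. Indeed, a monomial of degree at least [2 * d - 1] is
    a product of that many variables, weighted by [alpha], and the
    Erdos-Ginzburg-Ziv theorem [zero_sum] finds [d] of them with total weight
    divisible by [d]; the cofactor is again invariant. So the algebra [B]
    generated by [m] is spanned by the monomials with invariant exponent, and the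
    projection of [R] on this span is [B]-linear: this is the operator
    [reynolds].

    Geometry. As [k] is infinite, a form vanishes on the image exactly if it
    becomes zero when [m] is substituted. Irreducibility and density of the torus
    follow because [R] is a domain. The image is closed: if [w] satisfies all
    relations between the monomials, then the ideal of [R] generated by the
    [m_j - w_j] is proper, for by [reynoldsM] its contraction to [B] is generated
    by the same elements, and these vanish when [w_j] is substituted for [m_j]. By
    the Nullstellensatz the ideal has a zero, and this is a preimage of [w].

    Cohen-Macaulay property. The coordinate ring is isomorphic to [B]. It is
    noetherian by Hilbert's basis theorem. Prime chains in it have length at most
    [n.+1], because elements picked in their successive differences are
    algebraically independent ([prime_chain_independent]) while [R] has room for
    only [n.+1] independent elements, by a count of dimensions. Conversely, a
    maximal ideal of [B] contains, by the Nullstellensatz, [x_i ^ d - c_i] for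
    suitable constants [c_i]. These form a regular sequence in [R], hence in [B],
    ideals of [B] being contracted from [R]. So each localization has a regular
    sequence of length [n.+1]; since a regular sequence gives a prime chain of the
    same length ([regular_prime_chain]), depth and dimension are both [n.+1]. *)

Set Implicit Arguments.
Unset Strict Implicit.
Unset Printing Implicit Defensive.

Import GRing.Theory.

(** * The Erdos-Ginzburg-Ziv theorem *)

(** The terms are of any type, with weights: in the multiplicative step, blocks
    of terms become terms themselves. *)
Definition zero_sum_property (d : nat) : Prop :=
  forall (T : eqType) (w : T -> nat) (s : seq T), (d.*2.-1 <= size s)%N ->
    exists u v, [/\ perm_eq s (u ++ v), size u = d & (d %| \sum_(x <- u) w x)%N].

Section ErdosGinzburgZiv.
(* Restores lemmas on finite sets whose names are shared with classical sets. *)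
Import boot.fintype boot.finset.

Lemma card_supersets (T : finType) (E : {set T}) m : (#|E| <= m)%N ->
  #|[set I : {set T} | E \subset I & #|I| == m]| = 'C(#|T| - #|E|, m - #|E|).
Proof.
move=> Em.
have -> : #|T| - #|E| = #|~: E| by rewrite [RHS]cardsCs setCK.
have addK (A : {set T}) : A \subset ~: E -> (A :|: E) :\: E = A.
  by rewrite setDUl setDv setU0 => AE; apply/setDidPl; rewrite disjoints_subset.
rewrite -cards_draws -[RHS](card_in_imset (f := fun A => A :|: E)); last first.
  move=> A B; rewrite !inE => /andP[AE _] /andP[BE _] AB.
  by rewrite -(addK A AE) AB addK.
apply: eq_card => I; rewrite inE; apply/andP/imsetP.
  move=> [EI /eqP Im]; exists (I :\: E); last first.
    by rewrite -{1}(setID I E) (setIidPr EI) setUC.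
  by rewrite inE subsetDr cardsD (setIidPr EI) Im eqxx.
move=> [A + ->]; rewrite inE => /andP[AE /eqP Am]; split; first exact: subsetUr.
rewrite cardsU (_ : A :&: E = set0); first by rewrite cards0 subn0 Am subnK.
by apply/eqP; rewrite setI_eq0 disjoints_subset.
Qed.

Section ErdosGinzburgZivPrime.
Variables (p : nat) (p_pr : prime p).

Let p_gt0 : 0 < p := prime_gt0 p_pr.

Lemma prime_dvd_fact m : p %| m`! = (p <= m).
Proof.
apply/idP/idP => [|pm]; last by rewrite dvdn_fact // p_gt0.
rewrite fact_prod Euclid_dvd_prod // big_has => /hasP[i].
by rewrite mem_index_iota => /andP[i0 im] /dvdn_leq-/(_ i0)/leq_trans; apply.
Qed.

Lemma prime_dvd_bin N m : m < p -> N - m < p -> m <= N ->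
  (p %| 'C(N, m)) = (p <= N).
Proof.
move=> mp Nmp mN; rewrite -prime_dvd_fact -(bin_fact mN) !Euclid_dvdM //.
by rewrite !prime_dvd_fact ![p <= _]leqNgt mp Nmp !orbF.
Qed.

Local Open Scope ring_scope.

(** If no [p] of the elements summed to zero, then by Fermat the powers
    [(\sum_(i in I) a i) ^+ p.-1] would all be one, and their sum would be the
    nonzero number of sets [I]. After expansion, the monomial of an index map
    [f] occurs in this sum once for each [I] that contains the image of [f], and
    the number of these sets is divisible by [p]: it is a binomial coefficient
    whose upper entry is at least [p] and whose lower entries are below [p]. *)
Lemma zero_sum_subset (a : 'I_(p.*2.-1) -> 'F_p) :
  exists I : {set 'I_(p.*2.-1)}, #|I| = p /\ \sum_(i in I) a i = 0.
Proof.
have [I /andP[/eqP Ip /eqP I0]|nI] :=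
  pickP (fun I : {set 'I_(p.*2.-1)} => (#|I| == p) && (\sum_(i in I) a i == 0)).
  by exists I.
pose S := \sum_(I : {set 'I_(p.*2.-1)} | #|I| == p) (\sum_(i in I) a i) ^+ p.-1.
have dbl : (p.*2.-1 = p + p.-1)%N by lia.
have natF m : (m%:R == 0 :> 'F_p) = (p %| m)%N.
  by rewrite (dvdn_pcharf (pchar_Fp p_pr)).
have fermat (x : 'F_p) : x != 0 -> x ^+ p.-1 = 1.
  move=> x0; apply: (mulfI x0); rewrite mulr1 -exprS prednK //.
  by have := expf_card x; rewrite card_Fp.
have S1 : S != 0.
  rewrite /S (eq_bigr (fun=> 1)) => [|I Ip]; last first.
    by have := nI I; rewrite Ip /= => /negbT/fermat.
  rewrite sumr_const natF.
  have -> : #|[pred I : {set 'I_(p.*2.-1)} | #|I| == p]| = 'C(p.*2.-1, p).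
    have := card_supersets (T := 'I_(p.*2.-1)) (E := set0) (m := p).
    rewrite cards0 !subn0 card_ord => <- //; apply: eq_card => I.
    by rewrite !inE sub0set.
  rewrite dbl -bin_sub ?leq_addr // addKn.
  have := bin_ffact (p + p.-1) p.-1 => /(congr1 (fun m => p %| m)%N).
  rewrite Euclid_dvdM // prime_dvd_fact leqNgt prednK // leqnn orbF => ->.
  rewrite ffact_prod Euclid_dvd_prod // big_has; apply/hasPn => i _.
  have ip := ltn_ord i.
  have -> : (p + p.-1 - i = p + (p.-1 - i))%N by lia.
  rewrite dvdn_addr // gtnNdvd //; lia.
suff S0 : S = 0 by rewrite S0 eqxx in S1.
pose img (f : {ffun 'I_p.-1 -> 'I_(p.*2.-1)}) := [set f j | j in 'I_p.-1].
have expand (I : {set 'I_(p.*2.-1)}) : (\sum_(i in I) a i) ^+ p.-1 =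
    \sum_(f : {ffun 'I_p.-1 -> 'I_(p.*2.-1)} | img f \subset I) \prod_j a (f j).
  have -> : (\sum_(i in I) a i) ^+ p.-1 = \prod_(j < p.-1) \sum_(i in I) a i.
    by rewrite prodr_const card_ord.
  rewrite [X in \prod_(j < _) X]big_mkcond bigA_distr_bigA /=.
  rewrite [RHS]big_mkcond; apply: eq_bigr => f _.
  have [fI|] := boolP (img f \subset I).
    apply: eq_bigr => j _; have /(subsetP fI) -> // : f j \in img f.
    exact: imset_f.
  move=> /subsetPn[_ /imsetP[j _ ->] fjI].
  by rewrite (bigD1 j) //= (negPf fjI) mul0r.
rewrite /S (eq_bigr _ (fun I _ => expand I)).
rewrite (exchange_big_dep xpredT) //=; apply: big1 => f _.
rewrite sumr_const -mulr_natr; apply/eqP; rewrite mulf_eq0 natF.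
have p1 : (0 < p.-1)%N by have := prime_gt1 p_pr; lia.
have imgle : (#|img f| <= p.-1)%N.
  by rewrite -[X in (_ <= X)%N]card_ord leq_imset_card.
have img0 : (0 < #|img f|)%N.
  by rewrite card_gt0; apply/set0Pn; exists (f (Ordinal p1)); apply: imset_f.
have -> : #|[pred I : {set 'I_(p.*2.-1)} | (#|I| == p) && (img f \subset I)]|
    = 'C(p.*2.-1 - #|img f|, p - #|img f|).
  have := card_supersets (T := 'I_(p.*2.-1)) (E := img f) (m := p).
  rewrite card_ord => <-; last exact: leq_trans imgle (leq_pred _).
  by apply: eq_card => I; rewrite !inE andbC.
by rewrite prime_dvd_bin ?orbT //; lia.
Qed.

Lemma zero_sum_prime : zero_sum_property p.
Proof.
move=> T w s size_s; set N := p.*2.-1 in size_s.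
pose f := tnth (Tuple (introT eqP (size_takel size_s))).
have [I [Ip I0]] := zero_sum_subset (fun i => (w (f i))%:R).
exists (map f (filter (mem I) (enum 'I_N))),
  (map f (filter (predC (mem I)) (enum 'I_N)) ++ drop N s); split.
- rewrite catA -map_cat -[s in perm_eq s _](cat_take_drop N) perm_cat2r.
  rewrite perm_sym; apply: perm_trans (perm_map _ (permEl (perm_filterC _ _))) _.
  by rewrite map_tnth_enum.
- by rewrite size_map -[RHS]Ip cardE enumT.
rewrite big_map big_filter.
have := dvdn_pcharf (pchar_Fp p_pr) (\sum_(i <- enum 'I_N | (mem I) i) w (f i))%N.
by move=> ->; rewrite natr_sum -[X in _ == X]I0 big_enum_cond.
Qed.

End ErdosGinzburgZivPrime.

Lemma zero_sum_blocks d (T : eqType) (w : T -> nat) r (s : seq T) :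
  zero_sum_property d -> (d * r + d.-1 <= size s)%N ->
  exists (b : seq (seq T)) (v : seq T), [/\ perm_eq s (flatten b ++ v), size b = r
    & forall u, u \in b -> size u = d /\ (d %| \sum_(x <- u) w x)%N].
Proof.
move=> zd; elim: r s => [|r IH] s s_ge; first by exists [::], s.
have [|u [v [suv ud du]]] := zd T w s; first by lia.
have /perm_size := suv; rewrite size_cat ud => sv.
have [|b [v' [vb br bP]]] := IH v; first by nia.
exists (u :: b), v'; split=> [||x]; last first.
- by rewrite inE => /predU1P[->|/bP].
- by rewrite /= br.
by apply: perm_trans suv _; rewrite /= -catA perm_cat2l.
Qed.

(** Blocks of [d] terms, weighted by the [d]-th part of their weight, reduce the
    claim for a product to its factors. *)
Lemma zero_sumM d e : (0 < d)%N -> (0 < e)%N ->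
  zero_sum_property d -> zero_sum_property e -> zero_sum_property (d * e).
Proof.
move=> d0 e0 zd ze T w s s_ge.
have [|b [v [sb bsz bP]]] := @zero_sum_blocks d T w e.*2.-1 s zd; first by nia.
have [|u' [v' [bu u'e u'd]]] := ze _ (fun u => (\sum_(x <- u) w x) %/ d)%N b.
  by rewrite bsz.
have bu' x : x \in u' -> x \in b by rewrite (perm_mem bu) mem_cat => ->.
exists (flatten u'), (flatten v' ++ v); split.
- apply: perm_trans sb _; rewrite catA perm_cat2r -flatten_cat.
  exact: perm_flatten.
- rewrite size_flatten /shape sumnE big_map -u'e.
  rewrite (eq_big_seq (fun=> d)) => [|x /bu'/bP[] //].
  by rewrite big_const_seq count_predT iter_addn_0.
rewrite big_flatten (eq_big_seq (fun u => d * ((\sum_(x <- u) w x) %/ d)))%N.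
  by rewrite -big_distrr /= dvdn_pmul2l.
by move=> x /bu'/bP[_ /= dx]; rewrite mulnC divnK.
Qed.

(** The Erdos-Ginzburg-Ziv theorem, by splitting off one prime factor of [d] at a
    time. *)
Theorem zero_sum d : (0 < d)%N -> zero_sum_property d.
Proof.
have [l] := ubnP d; elim: l d => // l IH d; rewrite ltnS => dl d0.
have [d1|d1] := leqP d 1.
  have -> : d = 1%N by lia.
  by move=> T w [//|x s _]; exists [:: x], s; rewrite dvd1n.
have pd := pdiv_prime d1; have [p0 p1] := (prime_gt0 pd, prime_gt1 pd).
have dE := divnK (pdiv_dvd d); rewrite -dE mulnC.
apply: zero_sumM => //; [by nia | exact: zero_sum_prime|].
by apply: IH; nia.
Qed.

End ErdosGinzburgZiv.

Local Open Scope ring_scope.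
Local Open Scope classical_set_scope.
Local Open Scope quotient_scope.

(** * Ideals, regular sequences and prime chains *)

(** Unlike [idealr_closed], this allows the unit ideal, which contractions and
    generated ideals can be. *)
Definition ideal_set (R : comNzRingType) (J : set R) : Prop :=
  J 0 /\ forall a u v, J u -> J v -> J (a * u + v).

Section IdealTheory.
Variable R : comNzRingType.
Implicit Types (I Q M : {pred R}) (S J U : set R) (s : seq R).

Lemma ideal_setD J u v : ideal_set J -> J u -> J v -> J (u + v).
Proof. by move=> [_ JD] Ju Jv; rewrite -[u]mul1r; apply: JD. Qed.

Lemma ideal_setM J a u : ideal_set J -> J u -> J (a * u).
Proof. by move=> [J0 JD] Ju; rewrite -[_ * _]addr0; apply: JD. Qed.

Lemma ideal_setN J u : ideal_set J -> J u -> J (- u).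
Proof. by move=> JI Ju; rewrite -mulN1r; apply: ideal_setM. Qed.

Lemma ideal_setB J u v : ideal_set J -> J u -> J v -> J (u - v).
Proof. by move=> JI Ju Jv; apply: ideal_setD => //; apply: ideal_setN. Qed.

Lemma ideal_set_sum (T : Type) J (r : seq T) (P : pred T) (F : T -> R) :
  ideal_set J -> (forall i, P i -> J (F i)) -> J (\sum_(i <- r | P i) F i).
Proof.
move=> JI JF; elim/big_ind: _ => //; first by case: JI.
by move=> x y; apply: ideal_setD.
Qed.

Lemma ideal_gen_closed S : ideal_set (ideal_gen S).
Proof.
split=> [|a u v Su Sv]; first exact: ideal_gen0.
by apply: ideal_genD => //; apply: ideal_genM.
Qed.

Lemma ideal_gen_min S J : ideal_set J -> S `<=` J -> ideal_gen S `<=` J.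
Proof.
move=> JI SJ x [s sS ->]; rewrite big_seq; apply: ideal_set_sum => // p ps.
exact: ideal_setM (SJ _ (sS _ ps)).
Qed.

Lemma ideal_gen_mono S S' : S `<=` S' -> ideal_gen S `<=` ideal_gen S'.
Proof.
move=> SS'; apply: ideal_gen_min; first exact: ideal_gen_closed.
by move=> x /SS'; apply: ideal_gen_sub.
Qed.

Lemma idealr_closed_set I : idealr_closed I -> ideal_set [set` I].
Proof. by case=> I0 _ ID; split=> // a u v; apply: ID. Qed.

Lemma asbool_idealr J : ideal_set J -> ~ J 1 ->
  idealr_closed ((fun x => `[< J x >]) : {pred R}).
Proof.
move=> [J0 JD] J1; split; first exact/asboolP.
  by apply/negP => /asboolP.
by move=> a u v /asboolP Ju /asboolP Jv; apply/asboolP; apply: JD.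
Qed.

Lemma noetherian_set J : noetherian R -> ideal_set J ->
  exists s, J = seq_ideal s.
Proof.
move=> noeR JI; have [J1|J1] := pselect (J 1).
  exists [:: 1]; apply/seteqP; split=> x Jx.
    rewrite -[x]mulr1; apply: ideal_genM; apply: ideal_gen_sub.
    by rewrite /= inE.
  by rewrite -[x]mulr1; apply: ideal_setM.
have [s sE] := noeR _ (asbool_idealr JI J1); exists s; rewrite -sE.
by apply/seteqP; split=> x /asboolP.
Qed.

Lemma prime_idealP Q u v : prime_ideal Q -> u * v \in Q -> u \in Q \/ v \in Q.
Proof. by move=> [_ QP] /QP /orP. Qed.

Lemma prime_ideal1 Q : prime_ideal Q -> 1 \notin Q.
Proof. by case=> -[]. Qed.

Lemma prime_idealMl Q a u : prime_ideal Q -> u \in Q -> a * u \in Q.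
Proof.
by move=> [/idealr_closed_set QI _]; apply: (ideal_setM (J := [set` Q])).
Qed.

Lemma prime_idealX Q u i : prime_ideal Q -> u ^+ i \in Q -> u \in Q.
Proof.
move=> QP; elim: i => [|i IH]; first by rewrite expr0 (negPf (prime_ideal1 QP)).
by rewrite exprS => /(prime_idealP QP)[].
Qed.

(** By Zorn's lemma there is a maximal one among the ideals that contain [J] and
    avoid [U]. It is prime: two elements outside it give two elements of [U] in
    the enlarged ideals, and the product of these is in [U]. *)
Lemma prime_ideal_avoiding J U : ideal_set J ->
  U 1 -> (forall u v, U u -> U v -> U (u * v)) -> (forall x, J x -> ~ U x) ->
  exists Q, [/\ prime_ideal Q, (forall x, J x -> x \in Q)
              & forall x, x \in Q -> ~ U x].
Proof.
move=> JI U1 UM JU.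
pose good A := [/\ ideal_set A, J `<=` A & forall x, A x -> ~ U x].
(* The empty set is allowed because it is the union of the empty chain. *)
pose P (A : set R) := A = set0 \/ good A.
have [|A [PA Amax]] := @Zorn_bigcup _ P.
  move=> F FP Ftot.
  have [[B [FB Bn0]]|nB] := pselect (exists B, F B /\ B !=set0); last first.
    left; apply/seteqP; split=> // x [B FB Bx]; case: nB; exists B; split=> //.
    by exists x.
  have goodF C x : F C -> C x -> good C.
    by move=> FC Cx; case: (FP _ FC) => // C0; rewrite C0 in Cx.
  have [b Bb] := Bn0; have [BI JB BU] := goodF _ _ FB Bb.
  right; split; first 1 last.
  - by move=> x /JB Bx; exists B.
  - by move=> x [C FC Cx]; have [_ _] := goodF _ _ FC Cx; apply.
  split; first by exists B => //; case: BI.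
  move=> a u v [C FC Cu] [D FD Dv].
  have [CI _ _] := goodF _ _ FC Cu; have [DI _ _] := goodF _ _ FD Dv.
  case: (Ftot _ _ FC FD) => sub.
    by exists D => //; case: DI => _; apply => //; apply: sub.
  by exists C => //; case: CI => _; apply => //; apply: sub.
have gA : good A.
  case: PA => // A0; case: (Amax J); last by right; split.
  rewrite A0; split=> // /(_ 0); apply; by case: JI.
have [AI JA AU] := gA.
have A1 : ~ A 1 by move/AU; apply.
have extend u : ~ A u -> exists a r, A a /\ U (a + r * u).
  move=> nAu; apply: contrapT => nU.
  pose B : set R := [set x | exists a r, A a /\ x = a + r * u].
  case: (Amax B).
    split; first by move=> x Ax; exists x, 0; rewrite mul0r addr0.
    move=> BA; apply: nAu; apply: BA; exists 0, 1; rewrite mul1r add0r.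
    by split=> //; case: AI.
  right; split.
  - split; first by exists 0, 0; rewrite mul0r addr0; split=> //; case: AI.
    move=> b _ _ [a [r [Aa ->]]] [a' [r' [Aa' ->]]].
    exists (b * a + a'), (b * r + r'); split; last by ring.
    by case: AI => _; apply.
  - by move=> x /JA Ax; exists x, 0; rewrite mul0r addr0.
  by move=> _ [a [r [Aa ->]]] Ux; apply: nU; exists a, r.
exists (fun x => `[< A x >]); split.
- split; first exact: asbool_idealr.
  move=> u v /asboolP Auv.
  have [Au|Au] := pselect (A u); first by apply/orP; left; apply/asboolP.
  have [Av|Av] := pselect (A v); first by apply/orP; right; apply/asboolP.
  have [a [r [Aa Ua]]] := extend _ Au; have [b [t [Ab Ub]]] := extend _ Av.
  case: (AU _ _ (UM _ _ Ua Ub)).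
  have -> : (a + r * u) * (b + t * v)
      = (b + t * v) * a + (r * u * b + r * t * (u * v)) by ring.
  by apply: AI.2 => //; apply: AI.2 => //; apply: ideal_setM.
- by move=> x /JA Ax; apply/asboolP.
- by move=> x /asboolP; apply: AU.
Qed.

(** An ideal modulo which [f] is regular lies, inside any prime [M] above it and
    [f], in a prime without [f]: no product of a power of [f] and of an element
    outside [M] lies in the ideal. Iterated, this bounds depth by dimension. *)
Lemma regular_prime_chain s M :
  prime_ideal M -> {subset s <= M} ->
  (forall i, (i < size s)%N -> forall a : R,
     seq_ideal (take i s) (s`_i * a) -> seq_ideal (take i s) a) ->
  exists P, prime_chain (size s) P /\ P (size s) = M.
Proof.
elim/last_ind: s M => [|s f IH] M MP sM reg.
  exists (fun=> M); split=> //; split=> // i; by rewrite ltn0.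
have fM : f \in M by apply: sM; rewrite mem_rcons inE eqxx.
have {}sM x : x \in s -> x \in M.
  by move=> xs; apply: sM; rewrite mem_rcons inE xs orbT.
have regf i a : seq_ideal s (f ^+ i * a) -> seq_ideal s a.
  elim: i => [|i IHi]; first by rewrite expr0 mul1r.
  rewrite exprS -mulrA => h; apply: IHi.
  have := reg (size s); rewrite size_rcons leqnn nth_rcons ltnn eqxx.
  by rewrite -cats1 take_size_cat //; apply.
have JM x : seq_ideal s x -> x \in M.
  apply: (@ideal_gen_min _ [set` M]) => //.
  by apply: idealr_closed_set; case: MP.
pose U x := exists i u, u \notin M /\ x = f ^+ i * u.
have [||||Q [QP sQ QU]] := @prime_ideal_avoiding (seq_ideal s) U.
- exact: ideal_gen_closed.
- by exists 0%N, 1; rewrite expr0 mul1r; split=> //; apply: prime_ideal1.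
- move=> _ _ [i [u [uM ->]]] [j [v [vM ->]]]; exists (i + j)%N, (u * v).
  split; last by rewrite exprD; ring.
  by apply/negP => /(prime_idealP MP)[]; apply/negP.
- by move=> x sx [i [u [uM xE]]]; rewrite xE in sx; move/regf/JM: sx; apply/negP.
have QM : {subset Q <= M}.
  move=> x xQ; apply/negPn/negP => xM; apply: (QU x xQ).
  by exists 0%N, x; rewrite expr0 mul1r.
have fQ : f \notin Q.
  apply/negP => fQ; apply: (QU f fQ); exists 1%N, 1; rewrite mulr1 expr1.
  by split=> //; apply: prime_ideal1.
have [||P [[Ppr Plt] PQ]] := IH Q QP.
- by move=> x xs; apply: sQ; apply: ideal_gen_sub.
- move=> i i_s a; have := reg i; rewrite size_rcons nth_rcons i_s.
  by rewrite -cats1 takel_cat ?(ltnW i_s) //; apply; rewrite ltnW.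
exists (fun i => if (i <= size s)%N then P i else M).
rewrite size_rcons ltnn; split=> //; split=> i.
  by case: ifP => [i_s _|//]; apply: Ppr.
rewrite ltnS => i_s; rewrite i_s; case: ltnP => [|si]; first exact: Plt.
have -> : i = size s by apply/eqP; rewrite eqn_leq i_s si.
by rewrite PQ; split=> // /(_ f fM); apply/negP.
Qed.

(** Depth never exceeds dimension, so a single regular sequence that is as long
    as the bound on the prime chains determines both. *)
Lemma CM_local_criterion M s :
  noetherian R -> local_with M -> {subset s <= M} -> regular_seq s ->
  (forall l P, @prime_chain R l P -> (l <= size s)%N) -> CM_local R.
Proof.
move=> noeR locM sM regs bound; split=> //; exists M; split=> //.
have MP : prime_ideal M by apply: maximal_ideal_prime; case: locM.
exists (size s); split; split.
- by exists s.
- move=> t tM [regt _]; have [P [chP _]] := regular_prime_chain MP tM regt.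
  exact: bound chP.
- by have [P [chP _]] := regular_prime_chain MP sM regs.1; exists P.
- by move=> l [P]; apply: bound.
Qed.

Lemma seq_idealP s x : seq_ideal s x <->
  exists c : 'I_(size s) -> R, x = \sum_i c i * s`_i.
Proof.
split=> [|[c ->]]; last first.
  apply: ideal_set_sum => [|i _]; first exact: ideal_gen_closed.
  by apply: ideal_genM; apply: ideal_gen_sub; rewrite /= mem_nth.
move: x; apply: ideal_gen_min.
  split; first by exists (fun=> 0); rewrite big1 // => i _; rewrite mul0r.
  move=> a _ _ [c ->] [c' ->]; exists (fun i => a * c i + c' i).
  by rewrite mulr_sumr -big_split; apply: eq_bigr => i _; rewrite mulrDl mulrA.
move=> y /= ys; have yi : (index y s < size s)%N by rewrite index_mem.
exists (fun i => if i == Ordinal yi then 1 else 0).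
rewrite (bigD1 (Ordinal yi)) //= eqxx mul1r nth_index // big1 ?addr0 //.
by move=> i /negPf ->; rewrite mul0r.
Qed.

End IdealTheory.

Lemma seq_ideal_map (R T : comNzRingType) (f : {rmorphism R -> T}) s x :
  seq_ideal s x -> seq_ideal (map f s) (f x).
Proof.
have fI : ideal_set [set y | seq_ideal (map f s) (f y)].
  split; first by rewrite /= rmorph0; apply: ideal_gen0.
  move=> a u v /= Ju Jv; rewrite rmorphD rmorphM.
  by apply: ideal_genD => //; apply: ideal_genM.
apply: (ideal_gen_min fI) => y ys; apply: ideal_gen_sub.
by apply/mapP; exists y.
Qed.

Lemma seq_ideal_lift (R T : comNzRingType) (f : {rmorphism R -> T}) s x :
  (forall y, exists z, f z = y) -> seq_ideal (map f s) (f x) ->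
  exists z, seq_ideal s z /\ f z = f x.
Proof.
move=> fsurj /seq_idealP[c]; rewrite size_map in c * => xE.
have [g gE] := choice (fun i => fsurj (c i)).
exists (\sum_i g i * s`_i); split; first by apply/seq_idealP; exists g.
rewrite xE raddf_sum; apply: eq_bigr => i _.
by rewrite (nth_map 0) //= rmorphM gE.
Qed.

Lemma noetherian_surj (R T : comNzRingType) (f : {rmorphism R -> T}) :
  (forall y, exists x, f x = y) -> noetherian R -> noetherian T.
Proof.
move=> fsurj noeR I /idealr_closed_set [I0 ID].
have [|s sE] := @noetherian_set R [set x | f x \in I] noeR.
  split; first by rewrite /= rmorph0.
  by move=> a u v /= Iu Iv; rewrite rmorphD rmorphM; apply: ID.
exists (map f s); apply/seteqP; split=> y.
  have [x <-] := fsurj y => Ix; apply: seq_ideal_map.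
  by rewrite -sE.
apply: ideal_gen_min => // _ /mapP[x xs ->].
have : [set x | f x \in I] x by rewrite sE; apply: ideal_gen_sub.
by [].
Qed.

(** * Localization *)

Section Localization.
Variables (A : comNzRingType) (P : prime_idealr A).
Local Notation loc := (loc P).
Local Notation mk := (@Loc.mk A P).
Local Notation den1 := (Loc.den1 P).
Local Notation fr := (fun a => mk a den1).

Lemma mk_mul a s b t : (mk a s : loc) * mk b t = mk (a * b) (Loc.denM s t).
Proof. exact: Loc.mulE. Qed.

Lemma mk_add a s b t :
  (mk a s : loc) + mk b t = mk (a * sval t + b * sval s) (Loc.denM s t).
Proof. exact: Loc.addE. Qed.

Lemma fr_mul a b : fr (a * b) = fr a * fr b :> loc.
Proof. by rewrite mk_mul; apply/Loc.mkE; exists den1 => /=; ring. Qed.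

Lemma fr_add a b : fr (a + b) = fr a + fr b :> loc.
Proof. by rewrite mk_add; apply/Loc.mkE; exists den1 => /=; ring. Qed.

Lemma fr1 : fr 1 = 1 :> loc. Proof. by []. Qed.

Lemma fr0 : fr 0 = 0 :> loc. Proof. by []. Qed.

Lemma mk_fr a s : mk a s = mk 1 s * fr a :> loc.
Proof. by rewrite mk_mul; apply/Loc.mkE; exists den1 => /=; ring. Qed.

Lemma fr_mk a s : fr a = fr (sval s) * mk a s :> loc.
Proof. by rewrite mk_mul; apply/Loc.mkE; exists den1 => /=; ring. Qed.

Lemma mk_inv s : fr (sval s) * mk 1 s = 1 :> loc.
Proof. by rewrite -fr_mk fr1. Qed.

Lemma ideal_mkP (J : set loc) a s : ideal_set J -> J (mk a s) <-> J (fr a).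
Proof.
by move=> JI; split=> Ja; [rewrite (fr_mk a s) | rewrite mk_fr]; apply: ideal_setM.
Qed.

Lemma ideal_contraction (J : set loc) :
  ideal_set J -> ideal_set [set a | J (fr a)].
Proof.
move=> JI; split; first by rewrite /= fr0; case: JI.
by move=> a u v /= Ju Jv; rewrite fr_add fr_mul; case: JI => _; apply.
Qed.

(** An equation between fractions is an equation between numerators, up to a
    denominator. *)
Lemma seq_ideal_fr s a : seq_ideal (map fr s) (fr a : loc) ->
  exists u : Loc.den P, seq_ideal s (sval u * a).
Proof.
pose J : set loc := [set x | exists b t, x = mk b t /\ seq_ideal s b].
have JI : ideal_set J.
  split; first by exists 0, den1; split=> //; apply: ideal_gen0.
  move=> x _ _ [b [t [-> sb]]] [b' [t' [-> sb']]].
  have [[c r] /= ->] := Loc.mkP x; rewrite mk_mul mk_add.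
  exists (c * b * sval t' + b' * sval (Loc.denM r t)),
    (Loc.denM (Loc.denM r t) t').
  split=> //; apply: ideal_genD; rewrite mulrC; apply: ideal_genM => //.
  exact: ideal_genM.
move=> sa; have : J (fr a).
  apply: (ideal_gen_min JI) sa => _ /mapP[b bs ->]; exists b, den1.
  by split=> //; apply: ideal_gen_sub.
move=> [b [t [/Loc.mkE[u uE] sb]]]; exists (Loc.denM u t) => /=.
have -> : sval u * sval t * a = sval u * (a * sval t) by ring.
by rewrite uE; apply: ideal_genM; rewrite mulr1.
Qed.

Lemma seq_ideal_fr_sub s a : seq_ideal s a -> seq_ideal (map fr s) (fr a : loc).
Proof.
apply: (@ideal_gen_min _ _ [set a | seq_ideal (map fr s) (fr a : loc)]).
  exact: (ideal_contraction (ideal_gen_closed _)).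
by move=> b bs /=; apply: ideal_gen_sub; apply/mapP; exists b.
Qed.

(** Every ideal of the localization is generated by its contraction. *)
Lemma noetherian_loc : noetherian A -> noetherian loc.
Proof.
move=> noeA I /idealr_closed_set II.
have [s sE] := noetherian_set noeA (ideal_contraction II).
exists (map fr s); apply/seteqP; split=> x.
  have [[a t] /= ->] := Loc.mkP x => /(ideal_mkP _ _ II) => Ia.
  apply/ideal_mkP; first exact: ideal_gen_closed.
  by apply: seq_ideal_fr_sub; rewrite -sE.
apply: ideal_gen_min => // _ /mapP[b bs ->].
have : [set a | [set` I] (fr a)] b by rewrite sE; apply: ideal_gen_sub.
by [].
Qed.

Definition loc_max : {pred loc} :=
  fun x => `[< exists a s, a \in (P : {pred A}) /\ x = mk a s >].

Lemma loc_maxE a s : (mk a s \in loc_max) = (a \in (P : {pred A})).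
Proof.
apply/asboolP/idP => [[b [t [bP /Loc.mkE[u uE]]]]|aP]; last by exists a, s.
have : sval u * (a * sval t) \in (P : {pred A}).
  by rewrite uE; apply: idealMr; rewrite mulrC; apply: idealMr.
by rewrite !prime_idealrM (negPf (svalP u)) (negPf (svalP t)) orbF.
Qed.

Lemma loc_max_sub (J : {pred loc}) : idealr_closed J -> {subset J <= loc_max}.
Proof.
move=> JI x; have [[a s] /= ->] := Loc.mkP x; rewrite loc_maxE => Ja.
have [_ /negP J1 _] := JI; apply/negPn/negP => aP; apply: J1.
have JI' := idealr_closed_set JI.
rewrite -(mk_inv (exist _ a aP)) mulrC.
by apply: (ideal_setM (J := [set` J])) => //; apply/(ideal_mkP a s JI').
Qed.

Lemma loc_max_closed : idealr_closed loc_max.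
Proof.
split; first by rewrite -fr0 loc_maxE idealr0.
  by rewrite -fr1 loc_maxE idealr1.
move=> x u v.
have [[a s] /= ->] := Loc.mkP x; have [[b t] /= ->] := Loc.mkP u.
have [[c r] /= ->] := Loc.mkP v; rewrite mk_mul mk_add !loc_maxE => bP cP.
have PM y z : y \in (P : {pred A}) -> y * z \in (P : {pred A}).
  by move=> yP; rewrite mulrC idealMr.
by rewrite rpredD //; apply: (PM) => //; rewrite mulrC PM.
Qed.

Lemma local_with_loc : local_with loc_max.
Proof.
have mmax : maximal_ideal loc_max.
  by split=> [|J JI _]; [exact: loc_max_closed | exact: loc_max_sub].
split=> // J [JI Jmax] x; apply/idP/idP; first exact: loc_max_sub.
exact: (Jmax _ loc_max_closed (loc_max_sub JI)).
Qed.

Lemma regular_seq_loc (s : seq A) : {subset s <= (P : {pred A})} -> regular_seq s ->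
  regular_seq (map fr s : seq loc).
Proof.
move=> sP [reg _]; split.
  move=> i; rewrite size_map => i_s x.
  have [[a t] /= ->] := Loc.mkP x.
  rewrite (nth_map 0) // mk_mul -map_take.
  have gI := @ideal_gen_closed loc [set` map fr (take i s)].
  move/(ideal_mkP _ _ gI)/seq_ideal_fr => -[u].
  rewrite mulrCA => /(reg _ i_s) ua; apply/(ideal_mkP _ _ gI).
  have /seq_ideal_fr_sub : seq_ideal (take i s) (sval u * a) by [].
  rewrite fr_mul => /(ideal_genM (mk 1 u)).
  by rewrite mulrA [mk 1 u * _]mulrC mk_inv mul1r.
move=> h; have : 1 \in loc_max; last by case: loc_max_closed => _ /negPf ->.
apply: (@ideal_gen_min loc _ [set` loc_max]) h.
  exact: idealr_closed_set loc_max_closed.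
by move=> _ /mapP[a /sP aP ->] /=; rewrite loc_maxE.
Qed.

Lemma prime_chain_loc l (C : nat -> {pred loc}) :
  prime_chain l C -> exists C', @prime_chain A l C'.
Proof.
move=> [Cpr Clt]; exists (fun i a => fr a \in C i); split=> i il.
  have CP := Cpr i il; have CI := idealr_closed_set CP.1.
  split; last by move=> u v; rewrite -!topredE /= fr_mul => /(prime_idealP CP)/orP.
  split; last by move=> a u v; apply: (ideal_contraction CI).2.
    exact: (ideal_contraction CI).1.
  by rewrite -topredE /= fr1 (prime_ideal1 CP).
have [sub nsub] := Clt i il; split; first by move=> a; apply: sub.
have CI := idealr_closed_set (Cpr i (ltnW il)).1.
have CI' := idealr_closed_set (Cpr i.+1 il).1.
move=> nsub'; apply: nsub => x; have [[a t] /= ->] := Loc.mkP x.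
move/(ideal_mkP a t CI') => h; apply/(ideal_mkP a t CI).
exact: (nsub' a h).
Qed.

Lemma CM_local_loc (s : seq A) : noetherian A -> {subset s <= (P : {pred A})} ->
  regular_seq s -> (forall l C, @prime_chain A l C -> (l <= size s)%N) ->
  CM_local loc.
Proof.
move=> noeA sP regs bound.
apply: (@CM_local_criterion _ loc_max (map fr s)).
- exact: noetherian_loc.
- exact: local_with_loc.
- by move=> _ /mapP[a aS ->]; rewrite loc_maxE sP.
- exact: regular_seq_loc.
by move=> l C /prime_chain_loc[C' /bound]; rewrite size_map.
Qed.

End Localization.

(** * Isolating the last variable *)

Local Notation widen := (widen_ord (leqnSn _)).

(** This lets inductions on the number of variables pass through univariate
    polynomials. *)
Lemma mmap_muni n (R S : comNzRingType) (f : {rmorphism R -> S})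
    (h : 'I_n.+1 -> S) (p : {mpoly R[n.+1]}) :
  mmap f h p = (map_poly (mmap f (h \o widen)) (muni p)).[h ord_max].
Proof.
rewrite muniE raddf_sum horner_sum /mmap; apply: eq_bigr => m _.
rewrite /= map_polyZ map_polyXn /= mmapZ mmapX hornerZ hornerXn.
rewrite /mmap1 big_ord_recr /= mulrA; congr (f _ * _ * _).
by apply: eq_bigr => i _; rewrite mnmE.
Qed.

Lemma muni_inj n (R : comNzRingType) (p : {mpoly R[n.+1]}) :
  muni p = 0 -> p = 0.
Proof.
move=> p0; rewrite [p]mpolyE.
have -> : \sum_(m <- msupp p) p@_m *: 'X_[m]
    = mmap (@mpolyC _ R) (fun i => 'X_i) p.
  by apply: eq_bigr => m _; rewrite mmap1_id mul_mpolyC.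
by rewrite mmap_muni p0 map_poly0 horner0.
Qed.

Section MultivariateHorner.
Variables (n : nat) (R : comNzRingType).

(** The map back from univariate polynomials over [n] variables: the univariate
    indeterminate becomes the last variable. *)
Definition munihorner (q : {poly {mpoly R[n]}}) : {mpoly R[n.+1]} :=
  (map_poly (@mwiden n R) q).['X_ord_max].

Lemma munihorner_is_zmod_morphism : zmod_morphism munihorner.
Proof. by move=> p q; rewrite /munihorner rmorphB hornerD hornerN. Qed.

Lemma munihorner_is_monoid_morphism : monoid_morphism munihorner.
Proof.
split; first by rewrite /munihorner rmorph1 hornerC.
by move=> p q; rewrite /munihorner rmorphM hornerM.
Qed.

HB.instance Definition _ := GRing.isZmodMorphism.Build _ _ munihorner
  munihorner_is_zmod_morphism.
HB.instance Definition _ := GRing.isMonoidMorphism.Build _ _ munihorner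
  munihorner_is_monoid_morphism.

Lemma muniK p : munihorner (muni p) = p.
Proof.
rewrite /munihorner -(mmap_muni (@mpolyC _ R) (fun i => 'X_i)) [RHS]mpolyE.
by apply: eq_bigr => m _; rewrite mmap1_id mul_mpolyC.
Qed.

Lemma meval_munihorner (v : 'I_n.+1 -> R) q :
  (munihorner q).@[v] = (map_poly (meval (v \o widen)) q).[v ord_max].
Proof.
elim/poly_ind: q => [|q c IH]; first by rewrite rmorph0 map_poly0 horner0 meval0.
rewrite !rmorphD !rmorphM /= hornerD hornerM IH.
rewrite /munihorner !map_polyX !hornerX mevalXU !map_polyC !hornerC /=.
congr (_ + _); elim/mpolyind: c => [|a m p _ _ IHp]; first by rewrite !raddf0.
rewrite mwidenD !mevalD IHp mwidenZ mwidenX !mevalZ !mevalX.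
rewrite big_ord_recr /= mnmwiden_ordmax expr0 mulr1.
by congr (_ * _ + _); apply: eq_bigr => i _; rewrite mnmwiden_widen.
Qed.

End MultivariateHorner.

(** * Hilbert's basis theorem *)

Section HilbertBasis.
Variable D : comNzRingType.
Hypothesis noeD : noetherian D.
Implicit Types (f g : {poly D}) (I : set {poly D}).

(** Multiplication by a power of the indeterminate keeps the leading
    coefficient, so polynomials chosen in degree [N] cancel leading terms in all
    higher degrees as well. *)
Lemma reduce_lead I (s : seq D) N : ideal_set I ->
  (forall a, a \in s -> exists f, [/\ I f, (size f <= N.+1)%N & f`_N = a]) ->
  exists G : seq {poly D}, (forall g, g \in G -> I g) /\
    forall f m, (size f <= (N + m).+1)%N -> seq_ideal s f`_(N + m) ->
      exists g, seq_ideal G g /\ (size (f - g)%R <= N + m)%N.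
Proof.
move=> II sI.
have [F FP] : {F : D -> {poly D} & forall a, a \in s ->
    [/\ I (F a), (size (F a) <= N.+1)%N & (F a)`_N = a]}.
  apply: (choice (P := fun a f => a \in s -> [/\ I f, (size f <= N.+1)%N & f`_N = a])).
  move=> a; have [/sI[f fP]|_] := boolP (a \in s); first by exists f.
  by exists 0.
exists (map F s); split=> [_ /mapP[a as_ ->]|f m fsz /seq_idealP[c cE]].
  by have [] := FP a as_.
exists (\sum_i c i *: 'X^m * F s`_i); split.
  apply: ideal_set_sum => [|i _]; first exact: ideal_gen_closed.
  by apply/ideal_genM/ideal_gen_sub; rewrite /= map_f // mem_nth.
apply/leq_sizeP => j; rewrite leq_eqVlt => /orP[/eqP <-|ltj]; last first.
  rewrite coefB (leq_sizeP _ _ fsz) // coef_sum big1 ?subr0 // => i _.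
  have [_ Fsz _] := FP _ (mem_nth 0 (ltn_ord i)).
  rewrite -scalerAl coefZ coefXnM; case: ltnP => _; rewrite ?mulr0 //.
  by rewrite (leq_sizeP _ _ Fsz) ?mulr0 //; lia.
rewrite coefB cE coef_sum -sumrB big1 // => i _.
have [_ _ FN] := FP _ (mem_nth 0 (ltn_ord i)).
by rewrite -scalerAl coefZ coefXnM ltnNge leq_addl /= addnK FN subrr.
Qed.

(** Hilbert's basis theorem. The leading coefficients of all degrees form one
    ideal, and its generators occur in a common degree [N]; from there on they
    reduce the degree. The finitely many degrees below [N] are treated one at a
    time. *)
Lemma noetherian_poly : noetherian {poly D}.
Proof.
move=> I0 /idealr_closed_set; set I := [set` I0] => II.
suff [G [GI IG]] : exists G : seq {poly D},
    (forall g, g \in G -> I g) /\ forall f, I f -> seq_ideal G f.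
  by exists G; apply/seteqP; split=> //; apply: ideal_gen_min.
pose lead N : set D := [set a | exists f, [/\ I f, (size f <= N.+1)%N & f`_N = a]].
have leadI N : ideal_set (lead N).
  split; first by exists 0; rewrite size_poly0 coef0; split=> //; case: II.
  move=> a _ _ [f [If fN <-]] [g [Ig gN <-]]; exists (a *: f + g).
  split; last by rewrite coefD coefZ.
    by rewrite -mul_polyC; apply: II.2.
  by rewrite (leq_trans (size_polyD _ _)) // geq_max gN (leq_trans (size_scale_leq _ _)).
have lead_mono N m : lead N `<=` lead (N + m)%N.
  move=> _ [f [If fN <-]]; exists ('X^m * f); split; first exact: ideal_setM.
    rewrite (leq_trans (size_polyMleq _ _)) // size_polyXn.
    by lia.
  by rewrite coefXnM ltnNge leq_addl /= addnK.
pose L : set D := [set a | exists N, lead N a].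
have LI : ideal_set L.
  split; first by exists 0%N; case: (leadI 0%N).
  move=> a u v [N Nu] [M Mv]; exists (N + M)%N; apply: (leadI _).2.
    exact: lead_mono.
  by rewrite addnC; apply: lead_mono.
have [s sE] := noetherian_set noeD LI.
have [N sN] : exists N, forall a, a \in s -> lead N a.
  have : forall a, a \in s -> L a by move=> a as_; rewrite sE; apply: ideal_gen_sub.
  elim: (s) => [|a r IH] rL; first by exists 0%N.
  have [b br|M rM] := IH; first by apply: rL; rewrite inE br orbT.
  have [M' aM'] := rL a (mem_head _ _).
  exists (M + M')%N => b; rewrite inE => /predU1P[->|/rM]; last exact: lead_mono.
  by rewrite addnC; apply: lead_mono.
have [G1 [G1I G1red]] := reduce_lead II sN.
have [G2 [G2I G2gen]] : exists G : seq {poly D}, (forall g, g \in G -> I g) /\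
    forall f, I f -> (size f <= N)%N -> seq_ideal G f.
  elim: (N) => [|M [G [GI Ggen]]].
    exists [::]; split=> // f _; rewrite leqn0 size_poly_eq0 => /eqP ->.
    exact: ideal_gen0.
  have [t tE] := noetherian_set noeD (leadI M).
  have [|G' [G'I G'red]] := @reduce_lead I t M II.
    move=> a at_; suff : lead M a by [].
    by rewrite tE; apply: ideal_gen_sub.
  exists (G ++ G'); split=> [g|f If fM].
    by rewrite mem_cat => /orP[/GI|/G'I].
  have [||g [gG' fg]] := G'red f 0%N; rewrite ?addn0 //.
    by rewrite -tE; exists f.
  rewrite addn0 in fg; rewrite -(subrK g f).
  apply: ideal_genD; last first.
    by apply: (ideal_gen_mono _ gG') => x /= xG; rewrite mem_cat xG orbT.
  have Ig : I g by apply: ideal_gen_min gG'.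
  apply: (@ideal_gen_mono _ [set` G]); last by apply: Ggen => //; apply: ideal_setB.
  by move=> x /= xG; rewrite mem_cat xG.
exists (G1 ++ G2); split=> [g|f].
  by rewrite mem_cat => /orP[/G1I|/G2I].
have sub1 : seq_ideal G1 `<=` seq_ideal (G1 ++ G2).
  by apply: ideal_gen_mono => x /= xG; rewrite mem_cat xG.
have sub2 : seq_ideal G2 `<=` seq_ideal (G1 ++ G2).
  by apply: ideal_gen_mono => x /= xG; rewrite mem_cat xG orbT.
have [l] := ubnP (size f); elim: l f => // l IH f; rewrite ltnS => fl If.
have [/G2gen-/(_ If)/sub2//|Nf] := leqP (size f) N.
pose m := ((size f).-1 - N)%N.
have fE : size f = (N + m).+1 by rewrite /m; lia.
have [||g [gG1 fg]] := G1red f m; first by rewrite fE.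
  by rewrite -/(seq_ideal s) -sE; exists (N + m)%N; exists f; rewrite fE.
rewrite -(subrK g f); apply: ideal_genD; last exact: sub1.
apply: IH; first by rewrite (leq_ltn_trans fg) // -ltnS -fE.
by apply: ideal_setB => //; apply: ideal_gen_min gG1.
Qed.

End HilbertBasis.

Lemma noetherian_field (k : fieldType) : noetherian k.
Proof.
move=> I [I0 I1 ID]; exists [::]; apply/seteqP; split=> x; last first.
  by case=> -[|p r] rS ->; [rewrite big_nil | have := rS p (mem_head _ _)].
move=> /= Ix; have [->|x0] := eqVneq x 0; first exact: ideal_gen0.
by move: I1; rewrite -(mulVf x0) -[_ * _]addr0 ID.
Qed.

Lemma noetherian_mpoly (k : fieldType) n : noetherian {mpoly k[n]}.
Proof.
elim: n => [|n IH].
  apply: (noetherian_surj (f := @mpolyC 0 k)); last exact: noetherian_field.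
  by move=> p; exists p@_0%MM; apply: esym; exact: nvar0_mpolyC.
apply: (noetherian_surj (f := @munihorner n k)); last exact: noetherian_poly.
by move=> p; exists (muni p); apply: muniK.
Qed.

(** * The Nullstellensatz *)

(** Unlike in [rdivp_eq], the degree of the quotient is bounded. *)
Lemma pseudo_division (R : comNzRingType) (g p : {poly R}) : g != 0 ->
  exists i h r, [/\ lead_coef g ^+ i *: p = h * g + r, (size r < size g)%N
                  & (size h <= (size p).+1 - size g)%N].
Proof.
move=> g0; have sg : (0 < size g)%N by rewrite lt0n size_poly_eq0.
have [l] := ubnP (size p); elim: l p => // l IH p; rewrite ltnS => pl.
have [pg|gp] := ltnP (size p) (size g).
  by exists 0%N, 0, p; rewrite expr0 scale1r mul0r add0r size_poly0.
pose t := lead_coef p *: 'X^(size p - size g).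
pose p1 := lead_coef g *: p - t * g.
have p1p : (size p1 < size p)%N.
  rewrite -[X in (_ < X)%N](prednK (leq_trans sg gp)) ltnS.
  apply/leq_sizeP => j pj; rewrite coefB coefZ -scalerAl coefZ coefXnM.
  have -> : (j < size p - size g)%N = false by lia.
  move: pj; rewrite leq_eqVlt => /orP[/eqP <-|pj].
    have -> : ((size p).-1 - (size p - size g) = (size g).-1)%N by lia.
    by rewrite -!lead_coefE mulrC subrr.
  rewrite !nth_default ?mulr0 ?subrr //;
    by move: (size p) (size g) sg gp pj; clear; lia.
have [|i [h [r [E rg hp]]]] := IH p1; first by rewrite (leq_trans p1p).
exists i.+1, (h + (lead_coef g ^+ i) *: t), r; split=> //.
  have -> : lead_coef g ^+ i.+1 *: p
      = lead_coef g ^+ i *: p1 + (lead_coef g ^+ i *: t) * g.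
    by rewrite /p1 scalerBr scalerA -exprSr scalerAl subrK.
  by rewrite E; ring.
rewrite (leq_trans (size_polyD _ _)) // geq_max; apply/andP; split; first by lia.
rewrite (leq_trans (size_scale_leq _ _)) // (leq_trans (size_scale_leq _ _)) //.
by rewrite size_polyXn; lia.
Qed.

Section Nullstellensatz.
Variable k : closedFieldType.

Section Extension.
Variables (D : comNzRingType) (Q : {pred {poly D}}).
Hypothesis QP : prime_ideal Q.
Implicit Types (f g p : {poly D}) (J : set {poly D}).

Let coefQ f := forall i, (f`_i)%:P \in Q.

Let QI : ideal_set [set` Q] := idealr_closed_set QP.1.

Let QM a f : f \in Q -> a * f \in Q.
Proof. exact: (ideal_setM (J := [set` Q])). Qed.

Let QD f g : f \in Q -> g \in Q -> f + g \in Q.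
Proof. exact: (ideal_setD (J := [set` Q])). Qed.

Let QB f g : f \in Q -> g \in Q -> f - g \in Q.
Proof. exact: (ideal_setB (J := [set` Q])). Qed.

Let coefQ_in f : coefQ f -> f \in Q.
Proof.
move=> fQ; rewrite -[f]coefK poly_def.
apply: (@ideal_set_sum _ _ [set` Q]) => // i _.
by rewrite -mul_polyC mulrC; apply/QM/fQ.
Qed.

(** An element of least size among those of [J] that do not vanish modulo the
    constants of [Q] serves as divisor: remainders vanish modulo these. *)
Let min_divisor J : ideal_set J -> [set` Q] `<=` J ->
  (exists g, J g /\ ~ coefQ g) ->
  exists p, [/\ J p, (lead_coef p)%:P \notin Q
              & forall g, J g -> ~ coefQ g -> (size p <= size g)%N].
Proof.
move=> JI QJ [g0 [Jg0 g0Q]].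
pose S n := `[< exists g, [/\ J g, ~ coefQ g & size g = n] >].
have exS : exists n, S n by exists (size g0); apply/asboolP; exists g0.
case: (ex_minnP exS) => n /asboolP[p [Jp pQ pn]] nmin.
have pmin g : J g -> ~ coefQ g -> (size p <= size g)%N.
  by move=> Jg gQ; rewrite pn; apply: nmin; apply/asboolP; exists g.
exists p; split=> //; apply/negP => lQ.
have [p0|p0] := eqVneq p 0.
  apply: pQ => i; rewrite p0 coef0 polyC0; exact: QI.1.
pose p' := p - lead_coef p *: 'X^((size p).-1).
have Jp' : J p'.
  apply: ideal_setB => //; apply: QJ; rewrite -mul_polyC mulrC.
  exact: QM.
have p'sz : (size p' < size p)%N.
  have sp : (0 < size p)%N by rewrite lt0n size_poly_eq0.
  rewrite -(prednK sp) ltnS; apply/leq_sizeP => j.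
  rewrite leq_eqVlt => /orP[/eqP <-|ltj].
    by rewrite coefB coefZ coefXn eqxx mulr1 subrr.
  rewrite coefB coefZ coefXn gtn_eqF // mulr0 subr0 nth_default //.
  by rewrite -(prednK sp).
suff p'Q : ~ coefQ p' by have := pmin p' Jp' p'Q; rewrite leqNgt p'sz.
move=> p'Q; apply: pQ => i.
have -> : p`_i = p'`_i + (lead_coef p *: 'X^((size p).-1))`_i.
  by rewrite -coefD subrK.
rewrite polyCD; apply: QD; first exact: p'Q.
rewrite coefZ polyCM mulrC.
exact: QM.
Qed.

Let lead_notin0 p : (lead_coef p)%:P \notin Q -> p != 0.
Proof. by apply: contraNneq => ->; rewrite lead_coef0 polyC0; exact: QI.1. Qed.

Let small_coefQ J p g : ideal_set J ->
  (forall g, J g -> ~ coefQ g -> (size p <= size g)%N) ->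
  J g -> (size g < size p)%N -> coefQ g.
Proof.
by move=> JI pmin Jg gp; apply: contrapT => /(pmin _ Jg); rewrite leqNgt gp.
Qed.

(** Points of the base are extended to zeros of [Q] where [b] is nonzero. If [Q]
    is generated by constants, the new coordinate only has to avoid the roots of
    [b], and one coefficient of [b] must stay nonzero. Otherwise [Q] is, up to
    powers of the leading coefficient, generated by a polynomial [p] of least
    degree, and the new coordinate is a root of [p]. There [b] is nonzero as soon
    as a certain constant is: in the ideal spanned by [Q] and [b], an element of
    least degree among those that do not vanish modulo the constants of [Q] is
    itself constant, since [Q] is prime. *)
Lemma point_extension b : b \notin Q -> exists c : D, c%:P \notin Q /\
  forall phi : {rmorphism D -> k}, (forall a, a%:P \in Q -> phi a = 0) ->
  phi c != 0 -> exists z, (forall g, g \in Q -> (map_poly phi g).[z] = 0) /\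
    (map_poly phi b).[z] != 0.
Proof.
move=> bQ.
have map_coefQ (phi : {rmorphism D -> k}) g :
    (forall a, a%:P \in Q -> phi a = 0) -> coefQ g -> map_poly phi g = 0.
  by move=> phiQ gQ; apply/polyP => i; rewrite coef_map coef0; apply/phiQ/gQ.
have [Qc|nQc] := pselect (forall g, g \in Q -> coefQ g).
  have [j jQ] : exists j, (b`_j)%:P \notin Q.
    apply: contrapT => nj; case/negP: bQ; apply: coefQ_in => j.
    by apply: contrapT => jQ; apply: nj; exists j; apply/negP.
  exists b`_j; split=> // phi phiQ phij.
  have bn0 : map_poly phi b != 0.
    by apply: contraNneq phij => b0; rewrite -coef_map b0 coef0.
  have [z bz] := closed_nonrootP _ bn0; exists z; split=> // g gQ.
  by rewrite map_coefQ ?horner0 //; apply: Qc.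
have [|||p [pQ lQ pmin]] := @min_divisor [set` Q] => //.
  apply: contrapT => h; apply: nQc => g gQ; apply: contrapT => gc.
  by apply: h; exists g.
(* [J] is spanned by [Q] and [b]; its element [g] of least degree is constant. *)
pose J : set {poly D} := [set x | exists q h, q \in Q /\ x = q + h * b].
have JI : ideal_set J.
  split; first by exists 0, 0; rewrite mul0r addr0; split=> //; exact: QI.1.
  move=> a _ _ [q [h [qQ ->]]] [q' [h' [q'Q ->]]].
  exists (a * q + q'), (a * h + h'); split; last by ring.
  exact: QI.2.
have QJ : [set` Q] `<=` J by move=> q qQ; exists q, 0; rewrite mul0r addr0.
have Jb : J b by exists 0, 1; rewrite mul1r add0r; split=> //; exact: QI.1.
have bc : ~ coefQ b by move=> /coefQ_in bQ'; rewrite bQ' in bQ.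
have [|||g [Jg gl gmin]] := @min_divisor J => //; first by exists b.
have lXQ f i : (lead_coef f)%:P \notin Q -> (lead_coef f ^+ i)%:P \notin Q.
  by apply: contra; rewrite polyC_exp; apply: prime_idealX.
have gp : (size g < size p)%N.
  have [i [h [r [E rsz _]]]] := pseudo_division b (lead_notin0 lQ).
  have Jr : J r.
    have -> : r = - h * p + (lead_coef p ^+ i) *: b by rewrite E; ring.
    by apply: JI.2; [exact: QJ | rewrite -mul_polyC; apply: ideal_setM].
  apply: leq_ltn_trans rsz; apply: gmin => // /coefQ_in rQ.
  have : (lead_coef p ^+ i)%:P * b \in Q.
    rewrite mul_polyC E; apply: QD => //.
    exact: QM.
  by move=> /(prime_idealP QP)[]; apply/negP => //; apply: lXQ.
have gnc : ~ coefQ g by move=> gcQ; move: gl; rewrite lead_coefE (gcQ (size g).-1).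
have gc : (size g <= 1)%N.
  have [i [h [r [E rsz hsz]]]] := pseudo_division p (lead_notin0 gl).
  have Jr : J r.
    have -> : r = - h * g + (lead_coef g ^+ i) *: p by rewrite E; ring.
    by apply: JI.2 => //; rewrite -mul_polyC; apply: ideal_setM => //; exact: QJ.
  have rc : coefQ r by apply: (small_coefQ JI gmin).
  have : h * g \in Q.
    have -> : h * g = (lead_coef g ^+ i)%:P * p - r by rewrite mul_polyC E; ring.
    apply: QB => //; last exact: coefQ_in.
    exact: QM.
  move=> /(prime_idealP QP)[hQ|gQ]; last first.
    by have := pmin g gQ gnc; rewrite leqNgt gp.
  have [hc|/(pmin _ hQ) ph] := pselect (coefQ h); last by lia.
  have : (lead_coef g ^+ i * lead_coef p)%:P \in Q.
    rewrite (lead_coefE p) -coefZ E coefD polyCD.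
    apply: QD => //.
    rewrite coefM rmorph_sum; apply: (@ideal_set_sum _ _ [set` Q]) => // j _.
    by rewrite /= polyCM mulrC; apply: QM => //; apply: hc.
  rewrite polyCM => /(prime_idealP QP)[lgQ|lpQ]; last by rewrite lpQ in lQ.
  by have := lXQ g i gl; rewrite lgQ.
have gE : g = (lead_coef g)%:P.
  rewrite lead_coefE {1}(size1_polyC gc); congr _%:P.
  by case: (size g) gc => [|[]].
exists (lead_coef p * lead_coef g); split.
  by rewrite polyCM; apply/negP => /(prime_idealP QP)[]; apply/negP.
move=> phi phiQ; rewrite rmorphM mulf_eq0 negb_or => /andP[phip phig].
have psz : size (map_poly phi p) != 1.
  rewrite size_map_poly_id0 // neq_ltn; apply/orP; right.
  by apply: leq_ltn_trans gp; rewrite lt0n size_poly_eq0 lead_notin0.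
have [z /rootP pz] := closed_rootP _ psz.
have Qz q : q \in Q -> (map_poly phi q).[z] = 0.
  move=> qQ; have [i [h [r [E rsz _]]]] := pseudo_division q (lead_notin0 lQ).
  have rQ : r \in Q.
    have -> : r = - h * p + (lead_coef p ^+ i) *: q by rewrite E; ring.
    apply: QI.2 => //; rewrite -mul_polyC.
    exact: QM.
  have /(congr1 (fun f => (map_poly phi f).[z])) := E.
  rewrite map_polyZ rmorphD rmorphM /= hornerZ hornerD hornerM pz mulr0 add0r.
  rewrite (map_coefQ _ r) ?horner0 //; last exact: (small_coefQ QI pmin).
  by move/eqP; rewrite mulf_eq0 rmorphXn expf_eq0 (negPf phip) andbF => /eqP.
exists z; split=> //; case: Jg => q [h [qQ gEq]].
apply: contraNneq phig => bz.
have -> : phi (lead_coef g) = (map_poly phi g).[z].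
  by rewrite {2}gE map_polyC hornerC.
by rewrite gEq rmorphD rmorphM /= hornerD hornerM bz mulr0 addr0 Qz.
Qed.

End Extension.

(** Nullstellensatz for primes: off the zero set of [b], a point of the zero set
    of [Q] is built one coordinate at a time. *)
Lemma prime_point n (Q : {pred {mpoly k[n]}}) b : prime_ideal Q -> b \notin Q ->
  exists v : 'I_n -> k, (forall g, g \in Q -> g.@[v] = 0) /\ b.@[v] != 0.
Proof.
elim: n Q b => [|n IH] Q b QP bQ.
  have QI := idealr_closed_set QP.1.
  have inQ (g : {mpoly k[0]}) : g \in Q -> g@_0%MM = 0.
    move=> gQ; apply/eqP; apply: contraTT (prime_ideal1 QP) => g0.
    rewrite negbK (_ : 1 = (g@_0%MM)^-1%:MP * g); first exact: prime_idealMl.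
    by rewrite {2}[g]nvar0_mpolyC -mpolyCM mulVf.
  exists (fun=> 0); split=> [g /inQ|].
    by rewrite {2}[g]nvar0_mpolyC mevalC.
  rewrite [b]nvar0_mpolyC mevalC; apply: contraNneq bQ => b0.
  by rewrite [b]nvar0_mpolyC b0 mpolyC0; exact: QI.1.
pose Q' : {pred {poly {mpoly k[n]}}} := fun q => munihorner q \in Q.
have Q'E q : (q \in Q') = (munihorner q \in Q) by [].
have QI := idealr_closed_set QP.1.
have Q'P : prime_ideal Q'.
  split; last first.
    by move=> u v; rewrite !Q'E rmorphM => /(prime_idealP QP)/orP.
  split; first by rewrite Q'E rmorph0; exact: QI.1.
    by rewrite Q'E rmorph1 prime_ideal1.
  by move=> a u v; rewrite !Q'E rmorphD rmorphM; apply: QI.2.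
have [|c [cQ cext]] := @point_extension _ Q' Q'P (muni b).
  by rewrite Q'E muniK.
pose Q0 : {pred {mpoly k[n]}} := fun a => a%:P \in Q'.
have Q0E a : (a \in Q0) = (a%:P \in Q') by [].
have Q'I := idealr_closed_set Q'P.1.
have Q0P : prime_ideal Q0.
  split; last first.
    by move=> u v; rewrite !Q0E polyCM => /(prime_idealP Q'P)/orP.
  split; first by rewrite Q0E polyC0; exact: Q'I.1.
    by rewrite Q0E prime_ideal1.
  by move=> a u v; rewrite !Q0E polyCD polyCM; apply: Q'I.2.
have [v [vQ vc]] := IH Q0 c Q0P cQ.
have [z [zQ zb]] := cext (meval v) vQ vc.
pose w (i : 'I_n.+1) := if insub (val i) is Some j then v j else z.
have ww : w \o widen =1 v.
  by move=> i; rewrite /w /= insubT //= => ilt; congr v; apply: val_inj.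
have wmax : w ord_max = z by rewrite /w /= insubF //= ltnn.
have wE q : (munihorner q).@[w] = (map_poly (meval v) q).[z].
  rewrite meval_munihorner wmax; congr (_.[z]); apply: eq_map_poly => p.
  exact: meval_eq.
exists w; split=> [g gQ|].
  by rewrite -[g]muniK wE zQ // Q'E muniK.
by rewrite -[b]muniK wE.
Qed.

(** A prime ideal that avoids [1] suffices. *)
Lemma nullstellensatz n (J : set {mpoly k[n]}) : ideal_set J -> ~ J 1 ->
  exists v : 'I_n -> k, forall g, J g -> g.@[v] = 0.
Proof.
move=> JI J1; have [||Q [QP JQ _]] := @prime_ideal_avoiding _ J [set 1] JI erefl.
- by move=> u v -> ->; rewrite mulr1.
- by move=> x Jx x1; apply: J1; rewrite -x1.
have [v [vQ _]] := prime_point QP (prime_ideal1 QP).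
by exists v => g /JQ /vQ.
Qed.

(** This is [prime_point] for the zero ideal. *)
Lemma mpoly_nonroot n (p : {mpoly k[n]}) : p != 0 ->
  exists v : 'I_n -> k, p.@[v] != 0.
Proof.
move=> p0; have [||v [_ vp]] := @prime_point n (pred1 0) p.
- split; last by move=> u v; rewrite !inE mulf_eq0.
  split; rewrite ?inE ?oner_eq0 // => a u v; rewrite !inE => /eqP -> /eqP ->.
  by rewrite mulr0 addr0.
- by rewrite inE.
by exists v.
Qed.

End Nullstellensatz.

(** * The length of prime chains *)

(** Elements picked in the successive differences of a prime chain are
    algebraically independent modulo its bottom: in a polynomial in them, the
    first one that occurs can be cancelled until a term without it appears, and
    this term is then tested modulo the next prime. *)
Lemma prime_chain_independent (k : fieldType) (A : comNzRingType)
    (iota : {rmorphism k -> A}) l (P : nat -> {pred A}) : prime_chain l P ->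
  exists h : 'I_l -> A, forall p : {mpoly k[l]}, p != 0 ->
    mmap iota h p \notin P 0%N.
Proof.
elim: l P => [|l IH] P [Ppr Plt].
  exists (fun=> 0) => p; rewrite [p]nvar0_mpolyC mpolyC_eq0 mmapC => p0.
  apply: contra (prime_ideal1 (Ppr 0%N isT)) => /(prime_idealMl (iota (p@_0%MM)^-1)).
  by rewrite -rmorphM mulVf // rmorph1; apply; apply: Ppr.
have [|h hP] := IH (P \o succn).
  by split=> i il; [apply: Ppr | apply: Plt].
have [P01 nP10] := Plt 0%N isT.
have [x xP1 xP0] : exists2 x, x \in P 1%N & x \notin P 0%N.
  apply: contrapT => nx; apply: nP10 => x x1; apply/negPn/negP => x0.
  by apply: nx; exists x.
have P0pr := Ppr 0%N isT.
pose h' (i : 'I_l.+1) := if insub (val i) is Some j then h j else x.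
have hw : h' \o widen =1 h.
  by move=> i; rewrite /h' /= insubT //= => ilt; congr h; apply: val_inj.
have hmax : h' ord_max = x by rewrite /h' insubF //= ltnn.
exists h' => p p0; rewrite mmap_muni hmax.
have : muni p != 0 by apply: contraNneq p0 => /muni_inj ->.
elim/poly_ind: (muni p) => [|q c IHq]; first by rewrite eqxx.
have [->|c0] := eqVneq c 0.
  rewrite polyC0 addr0 mulf_eq0 polyX_eq0 orbF => /IHq qP.
  rewrite rmorphM /= map_polyX hornerM hornerX.
  by apply/negP => /(prime_idealP P0pr)[]; apply/negP.
move=> _; rewrite rmorphD rmorphM /= map_polyX map_polyC.
rewrite hornerD hornerM hornerX hornerC; apply: contra (hP c c0) => /P01.
have -> : mmap iota h c = mmap iota (h' \o widen) c.
  by apply: eq_bigr => m _; congr (_ * _); apply: mmap1_eq.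
set u := _.[x] * x; set w := mmap _ _ c => uw.
have P1I := idealr_closed_set (Ppr 1%N isT).1.
have -> : w = - u + (u + w) by rewrite addKr.
apply: (ideal_setD (J := [set` P 1%N])) => //.
by apply: ideal_setN => //; apply: ideal_setM.
Qed.

(** The [t ^ l] monomials in [l] given polynomials with exponents below [t] lie in
    a space whose dimension is polynomial in [t] of degree [n]. *)
Lemma algebraic_independence_bound (k : fieldType) n l (F : 'I_l -> {mpoly k[n]}) :
  (forall p : {mpoly k[l]}, mmap (@mpolyC n k) F p = 0 -> p = 0) -> (l <= n)%N.
Proof.
move=> Find.
pose bnd N (p : {mpoly k[n]}) := forall m, m \in msupp p -> (mdeg m <= N)%N.
have bndM N M p q : bnd N p -> bnd M q -> bnd (N + M)%N (p * q).
  move=> pN qM m /msuppM_le/allpairsP[[m1 m2] /= [/pN h1 /qM h2 ->]].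
  by rewrite mdegD leq_add.
have bnd1 : bnd 0%N 1 by move=> m; rewrite msupp1 inE => /eqP ->; rewrite mdeg0.
pose D := (\max_i msize (F i))%N.
have bndF i : bnd D (F i).
  move=> m /msize_mdeg_lt /ltnW h; apply: leq_trans h _.
  exact: (leq_bigmax (F := fun i => msize (F i))).
have bndX i j : bnd (D * j)%N (F i ^+ j).
  elim: j => [|j IH]; first by rewrite muln0 expr0.
  by rewrite exprS mulnS; apply: bndM.
have dim_bound t : (t ^ l <= (D * t * l).+1 ^ n)%N.
  pose J := {ffun 'I_l -> 'I_t}; pose B := {ffun 'I_n -> 'I_(D * t * l).+1}.
  pose expo (j : J) : 'X_{1..l} := [multinom (j i : nat) | i < l].
  pose expoB (b : B) : 'X_{1..n} := [multinom (b i : nat) | i < n].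
  have expo_inj : injective expo.
    move=> j j' /mnmP jj'; apply/ffunP => i; apply: val_inj.
    by have := jj' i; rewrite !mnmE.
  have bnd_mono j : bnd (D * t * l)%N (mmap1 F (expo j)).
    have : bnd (\sum_(i < l) D * expo j i)%N (mmap1 F (expo j)).
      apply: (big_ind2 (fun p N => bnd N p)) => // p N q N'.
      exact: bndM.
    move=> bj m /bj mj; apply: leq_trans mj _.
    have <- : (\sum_(i < l) D * t = D * t * l)%N.
      by rewrite sum_nat_const card_ord mulnC.
    rewrite leq_sum // => i _.
    by rewrite leq_mul2l mnmE ltnW ?orbT.
  pose M : 'M[k]_(#|J|, #|B|) :=
    \matrix_(a, b) (mmap1 F (expo (enum_val a)))@_(expoB (enum_val b)).
  suff : row_free M.
    rewrite -row_leq_rank => /leq_trans/(_ (rank_leq_col M)).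
    by rewrite !card_ffun !card_ord.
  rewrite -kermx_eq0; apply/eqP/row_matrixP => r; rewrite row0.
  have : row r (kermx M) *m M = 0 by rewrite -row_mul mulmx_ker row0.
  move: (row r _) => v vM.
  pose p : {mpoly k[l]} := \sum_a v 0 a *: 'X_[expo (enum_val a)].
  have p0 : p = 0.
    apply: Find; rewrite raddf_sum /=.
    apply/mpolyP => m; rewrite mcoeff0 raddf_sum /=.
    under eq_bigr => a _ do rewrite mmapZ mmapX mcoeffCM.
    have [mB|mB] := boolP [forall i, m i <= D * t * l]%N; last first.
      apply: big1 => a _; rewrite (memN_msupp_eq0 (m := m)) ?mulr0 //.
      apply: contra mB => /bnd_mono mm; apply/forallP => i.
      by apply: leq_trans mm; rewrite mdegE (bigD1 i) //= leq_addr.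
    pose b : B := [ffun i => inord (m i)].
    have -> : m = expoB b.
      by apply/mnmP => i; rewrite mnmE ffunE inordK // ltnS (forallP mB i).
    have /matrixP/(_ 0 (enum_rank b)) := vM; rewrite !mxE => {2}<-.
    by apply: eq_bigr => a _; rewrite !mxE enum_rankK.
  apply/rowP => a; rewrite !mxE.
  have /(congr1 (mcoeff (expo (enum_val a)))) := p0.
  rewrite mcoeff0 raddf_sum /= (bigD1 a) //= big1 => [|a' a'a].
    by rewrite addr0 mcoeffZ mcoeffX eqxx mulr1.
  rewrite mcoeffZ mcoeffX; case: eqP => [/expo_inj/enum_val_inj aa'|_].
    by rewrite aa' eqxx in a'a.
  by rewrite mulr0.
rewrite leqNgt; apply/negP => nl.
(* For [t >= 1] the bound gives [t ^ n.+1 <= (C * t) ^ n], hence [t <= C ^ n]. *)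
pose C := (D * l).+1; pose t := (C ^ n).+1.
have : (t ^ n.+1 <= (C * t) ^ n)%N.
  apply: leq_trans (leq_pexp2l _ nl) _ => //.
  apply: leq_trans (dim_bound t) _.
  case: (posnP n) => [n0|n0]; first by rewrite n0 !expn0.
  by rewrite leq_exp2r // /C; nia.
rewrite expnMn expnS leq_pmul2r ?expn_gt0 //.
by rewrite ltnn.
Qed.

(** Independent elements of [A] lift to the polynomial ring above it, and the
    images of the lifts under [phi] are again independent. *)
Lemma prime_chain_bound (k : fieldType) N n (A : comNzRingType)
    (pi : {rmorphism {mpoly k[N]} -> A})
    (phi : {rmorphism {mpoly k[N]} -> {mpoly k[n]}}) :
  (forall a, exists f, pi f = a) -> (forall f, phi f = 0 -> pi f = 0) ->
  (forall c, phi c%:MP = c%:MP) ->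
  forall l P, @prime_chain A l P -> (l <= n)%N.
Proof.
move=> pi_surj ker phiC l P chP.
have [h hP] := prime_chain_independent (pi \o @mpolyC N k) chP.
have [H HP] := choice (fun i => pi_surj (h i)).
apply: (@algebraic_independence_bound k n l (phi \o H)) => p pE.
apply/eqP; apply: contraT => /hP.
have -> : mmap (pi \o @mpolyC N k) h p = pi (mmap (@mpolyC N k) H p).
  rewrite /mmap raddf_sum; apply: eq_bigr => m _; rewrite /= rmorphM.
  congr (_ * _); rewrite rmorph_prod; apply: eq_bigr => i _.
  by rewrite rmorphXn /= HP.
rewrite ker; first by case/negP; case: chP => /(_ 0%N isT) [[]].
rewrite -pE /mmap raddf_sum; apply: eq_bigr => m _.
rewrite /= rmorphM phiC rmorph_prod; congr (_ * _).
by apply: eq_bigr => i _; rewrite rmorphXn.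
Qed.

(** * Linear maps given on monomials *)

Section LinearExtension.
Variables (R : comNzRingType) (N M : nat) (F : 'X_{1..N} -> {mpoly R[M]}).
Implicit Types p q : {mpoly R[N]}.

Definition lin_ext p : {mpoly R[M]} := \sum_(a <- msupp p) p@_a *: F a.

Lemma lin_extE w p : (msize p <= w)%N ->
  lin_ext p = \sum_(a : 'X_{1..N < w}) p@_a *: F a.
Proof.
move=> pw; set I : subFinType _ := 'X_{1..N < w}.
rewrite /lin_ext (big_mksub I) ?msupp_uniq //=; first last.
  by move=> x /msize_mdeg_lt /leq_trans; apply.
by rewrite big_rmcond //= => j /memN_msupp_eq0 ->; rewrite scale0r.
Qed.

Lemma lin_ext_is_linear : linear lin_ext.
Proof.
move=> c p q; pose w := maxn (msize (c *: p + q)) (maxn (msize p) (msize q)).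
rewrite !(@lin_extE w); first last.
- by rewrite leq_max leqnn.
- by rewrite !leq_max leqnn orbT.
- by rewrite !leq_max leqnn !orbT.
rewrite scaler_sumr -big_split; apply: eq_bigr => a _ /=.
by rewrite mcoeffD mcoeffZ scalerDl scalerA.
Qed.

HB.instance Definition _ :=
  GRing.isLinear.Build R {mpoly R[N]} {mpoly R[M]} _ lin_ext lin_ext_is_linear.

Lemma lin_extX a : lin_ext 'X_[a] = F a.
Proof. by rewrite /lin_ext msuppX big_seq1 mcoeffX eqxx scale1r. Qed.

(** Compatibility with a multiplication can be tested on monomials. *)
Lemma lin_extM q (q' : {mpoly R[M]}) :
  (forall a, lin_ext (q * 'X_[a]) = q' * F a) ->
  forall p, lin_ext (q * p) = q' * lin_ext p.
Proof.
move=> qX p; elim/mpolyind: p => [|c a p _ _ IH]; first by rewrite !(mulr0, raddf0).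
by rewrite mulrDr !raddfD /= IH mulrDr -scalerAr !linearZ /= qX lin_extX -scalerAr.
Qed.

End LinearExtension.

(** * Shifted powers of the variables form a regular sequence *)

Section RegularPowers.
Variables (k : fieldType) (N d : nat) (c : 'I_N -> k).
Hypothesis d_gt0 : (0 < d)%N.
Local Notation R := {mpoly k[N]}.

Definition shifted_powers : seq R :=
  [seq 'X_l ^+ d - (c l)%:MP | l <- enum 'I_N].

Section NormalForm.
Variable i : 'I_N.

Definition reduced_power (l : 'I_N) (a : nat) : R :=
  if (l < i)%N then (c l)%:MP ^+ (a %/ d) * 'X_l ^+ (a %% d) else 'X_l ^+ a.

(** Reduction modulo the first [i] polynomials, as a linear map: for [l < i], a
    factor [x_l ^+ d] is replaced by [c l]. *)
Definition reduced := lin_ext (fun a => \prod_l reduced_power l (a l)).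

HB.instance Definition _ := GRing.Linear.on reduced.

Lemma reduced_powerD l a :
  reduced_power l (d + a) =
    (if (l < i)%N then (c l)%:MP else 'X_l ^+ d) * reduced_power l a.
Proof.
rewrite /reduced_power; case: ifP => _; last by rewrite exprD.
by rewrite -[X in (X + _ )%N]mul1n divnMDl // add1n exprS modnMDl mulrA.
Qed.

Lemma reducedM l p :
  reduced ('X_l ^+ d * p) =
    (if (l < i)%N then (c l)%:MP else 'X_l ^+ d) * reduced p.
Proof.
apply: lin_extM => a; rewrite mpolyXn -mpolyXD lin_extX.
rewrite /= (bigD1 l) //= [in RHS](bigD1 l) //= mulrA.
rewrite -mpolyXn -reduced_powerD.
congr (_ * _); first by rewrite mnmDE mulmnE mnm1E eqxx mul1n.
apply: eq_bigr => j jl.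
by rewrite mnmDE mulmnE mnm1E eq_sym (negPf jl).
Qed.

Lemma mem_take_enum l : (l \in take i (enum 'I_N)) = (l < i)%N.
Proof. by rewrite in_take ?mem_enum // index_enum_ord. Qed.

Lemma reduced_ideal p : seq_ideal (take i shifted_powers) p -> reduced p = 0.
Proof.
move=> Jp; have : [set q | forall h, reduced (h * q) = 0] p.
  move: p Jp; apply: ideal_gen_min.
    split; first by move=> h; rewrite mulr0 raddf0.
    by move=> a u v u0 v0 h; rewrite mulrDr raddfD /= mulrA u0 v0 addr0.
  move=> q /=; rewrite -map_take => /mapP[l]; rewrite mem_take_enum => li -> h.
  rewrite mulrC mulrBl raddfB /= reducedM li !mul_mpolyC.
  by rewrite linearZ subrr.
by move=> /(_ 1); rewrite mul1r.
Qed.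

Lemma sub_reduced_ideal p : seq_ideal (take i shifted_powers) (p - reduced p).
Proof.
set J := seq_ideal _; have JI : ideal_set J by exact: ideal_gen_closed.
rewrite {1}[p]mpolyE /reduced /lin_ext -sumrB; apply: ideal_set_sum => // a _.
rewrite -scalerBr -mul_mpolyC; apply: ideal_setM => //; rewrite mpolyXE_id.
apply: (big_ind2 (fun u v => J (u - v))) => [|u u' v v' Ju Jv|l _].
- by rewrite subrr; case: JI.
- have -> : u * v - u' * v' = v * (u - u') + u' * (v - v') by ring.
  by apply: ideal_setD => //; apply: ideal_setM.
rewrite /reduced_power; case: ifP => li; last by rewrite subrr; case: JI.
rewrite {1}(divn_eq (a l) d) exprD mulnC exprM -mulrBl subrXX.
rewrite -mulrA mulrC; apply: ideal_setM => //.
apply: ideal_gen_sub; rewrite /= -map_take; apply/mapP; exists l => //.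
by rewrite mem_take_enum.
Qed.

End NormalForm.

(** The reduced polynomials are a set of representatives modulo the first [i]
    polynomials, and multiplication by the next one respects it. *)
Lemma shifted_powers_regular (i : 'I_N) p :
  seq_ideal (take i shifted_powers) (('X_i ^+ d - (c i)%:MP) * p) ->
  seq_ideal (take i shifted_powers) p.
Proof.
move=> /reduced_ideal; rewrite mulrBl raddfB /= reducedM ltnn mul_mpolyC.
rewrite linearZ /= -mul_mpolyC -mulrBl => /eqP; rewrite mulf_eq0 => /orP[|/eqP p0].
  move=> /eqP /(congr1 (mcoeff (U_(i) *+ d))).
  rewrite mcoeffB mpolyXn mcoeffX eqxx mcoeffC mcoeff0.
  have -> : (U_(i) *+ d == 0)%MM = false.
    apply/eqP => /mnmP /(_ i); rewrite mulmnE mnm1E eqxx mnm0E mul1n => d0.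
    by move: d_gt0; rewrite d0.
  by rewrite mulr0 subr0 => /eqP; rewrite oner_eq0.
by rewrite -[p]subr0 -p0; apply: sub_reduced_ideal.
Qed.

End RegularPowers.

(** * The algebra generated by the invariant monomials *)

Section MonomialAlgebra.
Variables (k : closedFieldType) (N d mu : nat) (wt : 'I_N -> nat).
Variable m : mu.-tuple {mpoly k[N]}.
Local Notation R := {mpoly k[N]}.
Local Notation S := {mpoly k[mu]}.

Definition weight (a : 'X_{1..N}) : nat := (\sum_i wt i * a i)%N.

Hypothesis d_gt0 : (0 < d)%N.
Hypothesis mP : forall p, p \in m <->
  exists a, [/\ p = 'X_[a], mdeg a = d & (d %| weight a)%N].

Lemma weightD a b : weight (a + b) = (weight a + weight b)%N.
Proof. by rewrite /weight -big_split; apply: eq_bigr => i _; rewrite mnmDE mulnDr. Qed.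

Lemma weightU i : weight U_(i) = wt i.
Proof.
rewrite /weight (bigD1 i) //= mnm1E eqxx muln1 big1 ?addn0 // => j ji.
by rewrite mnm1E eq_sym (negPf ji) muln0.
Qed.

Lemma weightMn a r : weight (a *+ r) = (weight a * r)%N.
Proof.
by rewrite /weight big_distrl; apply: eq_bigr => i _; rewrite mulmnE mulnA.
Qed.

Definition invariant_exponent a := (d %| mdeg a)%N && (d %| weight a)%N.

Lemma invariant_exponentD a b : invariant_exponent a ->
  invariant_exponent (a + b) = invariant_exponent b.
Proof.
by move=> /andP[da wa]; rewrite /invariant_exponent mdegD weightD !dvdn_addr.
Qed.

Lemma mnm_seq (a : 'X_{1..N}) : exists s : seq 'I_N, a = (\sum_(i <- s) U_(i))%MM.
Proof.
rewrite [a]multinomUE_id; elim/big_ind: _ => [|_ _ [s ->] [t ->]|i _].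
- by exists [::]; rewrite big_nil.
- by exists (s ++ t); rewrite big_cat.
exists (nseq (a i) i); elim: (a i) => [|r IH]; first by rewrite mulm0n big_nil.
by rewrite mulmS IH big_cons.
Qed.

Lemma mdeg_seq (s : seq 'I_N) : mdeg (\sum_(i <- s) U_(i))%MM = size s.
Proof.
by rewrite mdeg_sum (eq_bigr (fun=> 1%N)) ?sum1_size // => i _; rewrite mdeg1.
Qed.

Lemma weight_seq (s : seq 'I_N) :
  weight (\sum_(i <- s) U_(i))%MM = (\sum_(i <- s) wt i)%N.
Proof.
elim: s => [|i s IH]; last by rewrite !big_cons weightD weightU IH.
by rewrite !big_nil /weight big1 // => i _; rewrite mnm0E muln0.
Qed.

(** Generation in degree [d]: a product of more than [d] variables contains, by
    the Erdos-Ginzburg-Ziv theorem, a subproduct of degree [d] and of weight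
    divisible by [d], and the cofactor is again invariant. *)
Lemma monomial_generated (s : seq 'I_N) :
  (d %| size s)%N -> (d %| \sum_(i <- s) wt i)%N ->
  exists g : S, g \mPo m = 'X_[\sum_(i <- s) U_(i)].
Proof.
have [l] := ubnP (size s); elim: l s => // l IH s; rewrite ltnS => sl ds ws.
have [s0|s0] := posnP (size s).
  by exists 1; rewrite (size0nil s0) big_nil mpolyX0 comp_mpoly1.
have [sd|sd] := eqVneq (size s) d.
  have /mP/tnthP[j jE] : exists a, [/\ 'X_[\sum_(i <- s) U_(i)] = 'X_[a] :> R,
      mdeg a = d & (d %| weight a)%N].
    by exists (\sum_(i <- s) U_(i))%MM; rewrite mdeg_seq weight_seq.
  by exists 'X_j; rewrite comp_mpolyXU -tnth_nth jE.
have s2 : (d.*2.-1 <= size s)%N.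
  case/dvdnP: ds s0 sd => -[|[|r]] -> //; first by rewrite mul1n eqxx.
  by move=> _ _; rewrite !mulSn; lia.
have [u [v [suv ud wu]]] := zero_sum d_gt0 wt s2.
have /perm_size := suv; rewrite size_cat ud => sE.
have [||| g gE] := IH u; rewrite ?ud //; first by lia.
have [||| h hE] := IH v.
- by apply: leq_trans sl; rewrite sE -add1n leq_add2r.
- by move: ds; rewrite sE dvdn_addr.
- by move: ws; rewrite (perm_big _ suv) big_cat /= dvdn_addr.
exists (g * h); rewrite rmorphM /= gE hE -mpolyXD.
by rewrite (perm_big _ suv) big_cat.
Qed.

(** The projection on the span of the invariant monomials, which is the Reynolds
    operator of a group of diagonal matrices. *)
Definition reynolds : R -> R :=
  lin_ext (fun a => if invariant_exponent a then 'X_[a] else 0).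

HB.instance Definition _ := GRing.Linear.on reynolds.

(** So the algebra generated by [m] is a direct summand, as a module over
    itself, of the polynomial ring. *)
Lemma reynolds_image p : exists g : S, g \mPo m = reynolds p.
Proof.
rewrite /reynolds /lin_ext; elim/big_ind: _ => [|_ _ [g <-] [h <-]|a _].
- by exists 0; rewrite raddf0.
- by exists (g + h); rewrite raddfD.
case: ifP => [/andP[]|_]; last by exists 0; rewrite raddf0 scaler0.
have [s ->] := mnm_seq a; rewrite mdeg_seq weight_seq => da wa.
have [g gE] := monomial_generated da wa.
by exists ((p@_(\sum_(i <- s) U_(i))) *: g); rewrite linearZ /= gE.
Qed.

(** Adding an invariant exponent does not change whether an exponent is
    invariant. *)
Lemma reynoldsM (g : S) p : reynolds ((g \mPo m) * p) = (g \mPo m) * reynolds p.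
Proof.
move: p; rewrite comp_mpolyEX.
pose good (q : R) := forall p, reynolds (q * p) = q * reynolds p.
have goodM q r : good q -> good r -> good (q * r).
  by move=> gq gr p; rewrite -!mulrA gq gr.
have good1 : good 1 by move=> p; rewrite !mul1r.
suff : good (\sum_(u <- msupp g) g@_u *: ('X_[u] \mPo m)) by [].
elim/big_ind: _ => [p|q r gq gr p|u _ p]; first by rewrite !mul0r raddf0.
  by rewrite !mulrDl raddfD /= gq gr.
rewrite -!scalerAl linearZ /=; congr (_ *: _); move: p.
suff : good ('X_[u] \mPo m) by [].
rewrite comp_mpolyX; elim/big_ind: _ => [//|q r|j _]; first exact: goodM.
elim: (u j) => [|r IH]; first by rewrite expr0.
rewrite exprS; apply: goodM => //.
have /mP[a [-> da wa]] := mem_tnth j m.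
apply: lin_extM => b; rewrite -mpolyXD lin_extX invariant_exponentD.
  by case: ifP; rewrite ?mulr0 // mpolyXD.
by rewrite /invariant_exponent da dvdnn.
Qed.

Lemma reynoldsK (g : S) : reynolds (g \mPo m) = g \mPo m.
Proof.
rewrite -[g \mPo m]mulr1 reynoldsM; congr (_ * _).
rewrite -mpolyX0 /reynolds lin_extX /invariant_exponent mdeg0 dvdn0.
by rewrite /weight big1 ?dvdn0 // => i _; rewrite mnm0E muln0.
Qed.

(** The Reynolds operator, applied to a linear combination over the whole
    polynomial ring, makes its coefficients invariant. *)
Lemma seq_ideal_contract (s : seq S) (f : S) :
  seq_ideal [seq g \mPo m | g <- s] (f \mPo m) ->
  exists h, seq_ideal s h /\ h \mPo m = f \mPo m.
Proof.
move=> /seq_idealP[c]; rewrite size_map in c * => fE.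
have [g gE] := choice (fun i => reynolds_image (c i)).
exists (\sum_i g i * s`_i); split; first by apply/seq_idealP; exists g.
rewrite -[RHS]reynoldsK fE !raddf_sum; apply: eq_bigr => i _.
by rewrite (nth_map 0) // [in RHS]mulrC /= reynoldsM rmorphM /= gE mulrC.
Qed.

Lemma power_index i : exists j, tnth m j = 'X_i ^+ d.
Proof.
have /mP/tnthP[j ->] : exists a, [/\ 'X_i ^+ d = 'X_[a] :> R, mdeg a = d
    & (d %| weight a)%N].
  exists (U_(i) *+ d)%MM; rewrite mpolyXn mdegMn mdeg1 mul1n weightMn.
  by rewrite dvdn_mull.
by exists j.
Qed.

Section Quotient.
Variables (A : comNzRingType) (pi : {rmorphism S -> A}).
Hypothesis pi_surj : forall a, exists f, pi f = a.
Hypothesis pi_ker : forall f, pi f = 0 <-> f \mPo m = 0.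

Lemma pi_eq f g : pi f = pi g <-> f \mPo m = g \mPo m.
Proof.
split=> /eqP; rewrite -subr_eq0 => /eqP; rewrite -raddfB.
  by move=> /pi_ker /eqP; rewrite raddfB subr_eq0 => /eqP.
by move=> /pi_ker /eqP; rewrite raddfB subr_eq0 => /eqP.
Qed.

(** A maximal ideal lies over a point [v]; subtracting from the [x_i ^+ d] their
    values there gives a regular sequence in it as long as the dimension. *)
Lemma CM_quotient : cohen_macaulay A.
Proof.
have noeA : noetherian A.
  by apply: (noetherian_surj (f := pi)) => //; apply: noetherian_mpoly.
split=> //.
move=> P Pmax; have [PI Pm] := Pmax; have PI' := idealr_closed_set PI.
have [||v vP] := @nullstellensatz k mu [set f | pi f \in (P : {pred A})].
- split; first by rewrite /= rmorph0; exact: PI'.1.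
  by move=> a f g /= fP gP; rewrite rmorphD rmorphM; apply: PI'.2.
- by rewrite /= rmorph1; case: PI => _ /negP.
(* [Q] is the ideal of the point [v]; it contains [P], hence equals it. *)
pose Q : {pred A} := fun a => `[< exists f, pi f = a /\ f.@[v] = 0 >].
have QP : {subset Q <= (P : {pred A})}.
  apply: Pm; last first.
    move=> a aP; have [f fa] := pi_surj a; apply/asboolP; exists f; split=> //.
    by apply: vP; rewrite /= fa.
  split; first by apply/asboolP; exists 0; rewrite rmorph0 meval0.
    apply/negP => /asboolP[f [f1 fv]].
    have : (f - 1).@[v] = 0.
      by apply: vP; rewrite /= rmorphB rmorph1 f1 subrr; exact: PI'.1.
    by rewrite mevalB fv meval1 sub0r => /eqP; rewrite oppr_eq0 oner_eq0.
  move=> a b b' /asboolP[f [<- fv]] /asboolP[g [<- gv]].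
  have [h <-] := pi_surj a; apply/asboolP; exists (h * f + g).
  by rewrite rmorphD rmorphM mevalD mevalM fv gv mulr0 addr0.
have [j jE] := choice power_index.
pose t : seq S := [seq 'X_(j i) - (v (j i))%:MP | i <- enum 'I_N].
have tE : [seq g \mPo m | g <- t] = shifted_powers d (v \o j).
  rewrite -map_comp; apply: eq_map => i /=.
  by rewrite comp_mpolyB comp_mpolyC comp_mpolyXU -tnth_nth jE.
have tP : {subset map pi t <= (P : {pred A})}.
  move=> _ /mapP[_ /mapP[i _ ->] ->]; apply: QP; apply/asboolP.
  by eexists; split; first reflexivity; rewrite mevalB mevalC mevalXU subrr.
have tsz : size t = N by rewrite size_map size_enum_ord.
apply: (@CM_local_loc A P (map pi t)) => //.
- split; last first.
    move=> t1; have : [set` (P : {pred A})] 1.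
      by apply: (ideal_gen_min PI') t1 => a /tP.
    by case: PI => _ /negP.
  move=> i; rewrite size_map tsz => iN a; have [f <-] := pi_surj a.
  rewrite (nth_map 0) ?tsz // -rmorphM -map_take.
  move=> /(seq_ideal_lift pi_surj)[h [th /pi_eq hE]].
  have : seq_ideal [seq g \mPo m | g <- take i t] (h \mPo m).
    exact: (seq_ideal_map (comp_mpoly m)).
  rewrite hE map_take tE rmorphM /=.
  rewrite (nth_map (Ordinal iN)) ?size_enum_ord //.
  rewrite comp_mpolyB comp_mpolyC comp_mpolyXU -tnth_nth jE.
  have -> : nth (Ordinal iN) (enum 'I_N) i = Ordinal iN.
    by apply: val_inj; rewrite /= nth_enum_ord.
  move=> /(@shifted_powers_regular _ _ _ _ d_gt0 (Ordinal iN)).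
  rewrite -tE -map_take => /seq_ideal_contract[h' [th' /pi_eq <-]].
  exact: seq_ideal_map.
move=> l C; rewrite size_map tsz.
apply: (prime_chain_bound (phi := comp_mpoly m)) => //.
- by move=> f /pi_ker.
- by move=> c; rewrite /= comp_mpolyC.
Qed.

End Quotient.
End MonomialAlgebra.

(** * Vanishing of forms on points of projective space *)

Section Homogeneous.
Variables (k : fieldType) (N : nat).
Implicit Types (f g : {mpoly k[N]}) (v : 'rV[k]_N) (p : proj k N).

Lemma meval_row_homog r f c v : f \is r.-homog ->
  meval_row f (c *: v) = c ^+ r * meval_row f v.
Proof.
move=> homf; rewrite /meval_row !mevalE mulr_sumr.
apply: eq_big_seq => a af; rewrite mulrCA; congr (_ * _).
rewrite -(dhomog_mf homf af) /= mdegE -prodrXr -big_split /=.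
by apply: eq_bigr => j _; rewrite mxE exprMn.
Qed.

Lemma val_coords p : val p = <[coords p]>%VS.
Proof.
apply/esym/eqP; rewrite eqEdim -memvE memv_pick /= dim_vline coords_neq0.
by rewrite (eqP (valP p)).
Qed.

Lemma vanishesP f p : homogeneous f ->
  vanishes f p <-> meval_row f (coords p) = 0.
Proof.
move=> [r homf]; split=> [h|f0 v].
  by apply: h; [exact: memv_pick | exact: coords_neq0].
rewrite val_coords => /vlineP[c ->] _.
by rewrite (meval_row_homog _ _ homf) f0 mulr0.
Qed.

Lemma vanishes_point f v (v0 : v != 0) : homogeneous f ->
  vanishes f (Defs.point v0) <-> meval_row f v = 0.
Proof.
move=> [r homf]; split=> [h|f0 w /vlineP[c ->] _].
  by apply: h => //; exact: memv_line.
by rewrite (meval_row_homog _ _ homf) f0 mulr0.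
Qed.

Lemma vanishing_at_closed v : ideal_set [set f | meval_row f v = 0].
Proof.
split; first by rewrite /= /meval_row meval0.
move=> a f g /=; rewrite /meval_row mevalD mevalM => -> ->.
by rewrite mulr0 addr0.
Qed.

Lemma homogeneousM f g : homogeneous f -> homogeneous g -> homogeneous (f * g).
Proof. by move=> [r hf] [t hg]; exists (r + t)%N; apply: dhomogM. Qed.

End Homogeneous.

(** * The image of projective space *)

Section Image.
Variables (k : closedFieldType) (n d mu : nat) (alpha : 'I_n.+1 -> nat) (e : k).
Variables (m : mu.-tuple {mpoly k[n.+1]}) (he : d.-primitive_root e).
Hypothesis hm : lists_invariant_monomials d (diag_group alpha e) m.
Local Notation R := {mpoly k[n.+1]}.
Local Notation S := {mpoly k[mu]}.
Local Notation X := (invariant_variety he hm).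
Local Notation bpf := (invariant_monomials_bpf he hm).

Let d_gt0 : (0 < d)%N := prim_order_gt0 he.

Lemma mx_act_diagX (c : 'rV[k]_n.+1) a :
  mx_act (diag_mx c) 'X_[a] = (\prod_i c 0 i ^+ a i) *: 'X_[a].
Proof.
rewrite /mx_act comp_mpolyX (mpolyXE_id _ a) -mul_mpolyC rmorph_prod -big_split.
apply: eq_bigr => i _ /=; rewrite rmorphXn -exprMn; congr (_ ^+ _).
rewrite mul_mpolyC -mx_act_diag /mx_act comp_mpolyXU -tnth_nth //.
Qed.

(** The generator of the group multiplies the monomial with exponent [a] by
    [e ^+ weight alpha a]. *)
Lemma invariant_monomialP p : p \in m <->
  exists a, [/\ p = 'X_[a], mdeg a = d & (d %| weight alpha a)%N].
Proof.
have e0 : e != 0.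
  apply: contraTneq (oner_neq0 k) => e0.
  by rewrite -(prim_expr_order he) e0 expr0n eqn0Ngt d_gt0 eqxx.
have prodE (a : 'X_{1..n.+1}) :
    \prod_i (e ^+ alpha i) ^+ a i = e ^+ weight alpha a.
  by rewrite -prodrXr; apply: eq_bigr => i _; rewrite -exprM.
have [_ ->] := hm; split=> [[[a -> ad] inv]|[a [-> ad wa]]].
  exists a; split=> //; rewrite (prim_order_dvd he) -prodE.
  have := inv (diag_mx (\row_i e ^+ alpha i)); rewrite mx_act_diagX => h.
  have /(congr1 (mcoeff a)) := h (ex_intro2 _ _ (1 : int) I (expr1z _)).
  rewrite mcoeffZ mcoeffX eqxx mulr1 => prod1.
  apply/eqP; rewrite -[RHS]prod1.
  by apply: eq_bigr => i _; rewrite mxE.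
split; first by exists a.
move=> _ [j _ <-]; rewrite diag_mx_expz => [|i]; last by rewrite mxE expf_neq0.
rewrite mx_act_diagX (eq_bigr (fun i => ((e ^+ alpha i) ^+ a i) ^ j)); last first.
  by move=> i _; rewrite !mxE [LHS]exprnP exprzAC.
rewrite -(big_morph (fun x : k => x ^ j) (fun x y => expfzMl x y j) (exp1rz _ j)).
rewrite prodE; have /eqP -> : e ^+ weight alpha a == 1.
  by rewrite -(prim_order_dvd he).
by rewrite exp1rz scale1r.
Qed.

Let mP := invariant_monomialP.

Lemma tnth_homog j : tnth m j \is d.-homog.
Proof. by have /mP[a [-> <- _]] := mem_tnth j m; rewrite dhomogX. Qed.

Lemma comp_eval_forms (g : S) v :
  meval_row (g \mPo m) v = meval_row g (eval_forms m v).
Proof. by rewrite /meval_row comp_mpoly_meval; apply: meval_eq => i; rewrite mxE. Qed.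

Lemma comp_mpolyX_homog u : ('X_[u] : S) \mPo m \is (d * mdeg u).-homog.
Proof.
rewrite comp_mpolyX mdegE big_distrr /=.
apply: (big_ind2 (fun (p : R) r => p \is r.-homog)) => [|p r q t|j _].
- exact: dhomog1.
- exact: dhomogM.
- exact/dhomogMn/tnth_homog.
Qed.

Lemma comp_pihomog r (g : S) :
  (pihomog mdeg r g) \mPo m = pihomog mdeg (d * r) (g \mPo m).
Proof.
elim/mpolyind: g => [|c u g _ _ IH]; first by rewrite !raddf0.
rewrite !raddfD /= IH !linearZ /= pihomogX; congr (_ *: _ + _).
case: eqVneq => [<-|ur]; first by rewrite pihomog_dE // comp_mpolyX_homog.
rewrite raddf0 (pihomog_ne0 _ (comp_mpolyX_homog u)) //.
by rewrite eqn_pmul2l.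
Qed.

(** A point where the product of [p] and of all variables is nonzero lies in the
    torus. *)
Lemma torus_nonroot (p : R) : p != 0 ->
  exists v : 'rV[k]_n.+1, (forall i, v 0 i != 0) /\ meval_row p v != 0.
Proof.
move=> p0; have Xn0 : \prod_i 'X_i != 0 :> R.
  apply/prodf_neq0 => i _; apply/eqP => /(congr1 (mcoeff U_(i))) /eqP.
  by rewrite mcoeffX eqxx mcoeff0 oner_eq0.
have [v] := mpoly_nonroot (mulf_neq0 p0 Xn0).
rewrite mevalM mulf_eq0 negb_or rmorph_prod => /andP[pv /prodf_neq0 v0].
exists (\row_i v i); split=> [i|].
  by have := v0 i isT; rewrite /= mevalXU mxE.
by apply: contraNneq pv => <-; apply/eqP/meval_eq => i; rewrite mxE.
Qed.

Lemma row_neq0 (v : 'rV[k]_n.+1) i : v 0 i != 0 -> v != 0.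
Proof. by apply: contraNneq => ->; rewrite mxE. Qed.

Lemma invariant_variety_point v (v0 : v != 0) : X (Defs.point (bpf v0)).
Proof. by exists (Defs.point v0) => //; apply: proj_mapE; apply: tnth_homog. Qed.

(** A polynomial that vanishes at all points is zero, so the relations between
    the values of the monomials are the relations between the monomials. *)
Lemma vanishes_on_image g : homogeneous g ->
  (forall p, X p -> vanishes g p) <-> g \mPo m = 0.
Proof.
move=> homg; split=> [van|g0 p [q _ <-]]; last first.
  by apply/vanishes_point => //; rewrite -comp_eval_forms g0 /meval_row meval0.
apply/eqP; apply: contraT => /torus_nonroot[v [v0]].
rewrite comp_eval_forms => /eqP; case.
exact/(vanishes_point (bpf (row_neq0 (v0 ord0))) homg)/van/invariant_variety_point.
Qed.

(** Substitution of forms of degree [d] multiplies degrees by [d], so the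
    homogeneous components of a relation between them are relations. *)
Lemma vanishing_idealE f : f \in vanishing_ideal X <-> f \mPo m = 0.
Proof.
split=> [/asboolP|f0].
  move: f; apply: (@ideal_gen_min _ _ [set f | f \mPo m = 0]).
    split; first by rewrite /= raddf0.
    by move=> a u v /= u0 v0; rewrite raddfD /= rmorphM /= u0 v0 mulr0 addr0.
  by move=> g [homg]; rewrite vanishes_on_image.
apply/asboolP; rewrite [f](pihomog_partitionE (mf := mdeg) (leqnn _)).
apply: ideal_set_sum => [|r _]; first exact: ideal_gen_closed.
have homr : homogeneous (pihomog mdeg r f) by exists r; apply: pihomogP.
apply: ideal_gen_sub; split=> //; apply/vanishes_on_image => //.
by rewrite comp_pihomog f0 raddf0.
Qed.

(** A point that satisfies the relations between the monomials is the value of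
    the monomials at some [v]: otherwise the equations [m_j = w_j] would be
    contradictory, and the Reynolds operator would turn this contradiction into
    one between the coordinates of the point. *)
Lemma invariant_variety_closed : zariski_closed X.
Proof.
exists [set g | homogeneous g /\ g \mPo m = 0]; first by move=> g [].
apply/seteqP; split=> [p Xp g [homg g0]|p Tp].
  exact: ((vanishes_on_image homg).2 g0 p Xp).
pose w := coords p.
pose t : seq S := [seq 'X_j - (w 0 j)%:MP | j <- enum 'I_mu].
have [||v vt] := @nullstellensatz k n.+1 (seq_ideal [seq g \mPo m | g <- t]).
- exact: ideal_gen_closed.
- have /= := comp_mpoly1 m => {1}<- /(seq_ideal_contract d_gt0 mP)[h [th hE]].
  have hw : meval_row h w = 0.
    move: th; apply: (@ideal_gen_min _ _ [set f | meval_row f w = 0]).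
      exact: vanishing_at_closed.
    move=> _ /mapP[j _ ->].
    by rewrite /= /meval_row mevalB mevalXU mevalC subrr.
  have : meval_row (1 - h) w = 0.
    have : 1 - h \in vanishing_ideal X.
      by apply/vanishing_idealE; rewrite raddfB /= hE subrr.
    move=> /asboolP; apply: (@ideal_gen_min _ _ [set f | meval_row f w = 0]).
      exact: vanishing_at_closed.
    move=> g [homg van] /=; apply/(vanishesP p homg)/Tp; split=> //.
    exact/vanishes_on_image.
  by rewrite /meval_row mevalB meval1 [meval _ h]hw subr0 => /eqP; rewrite oner_eq0.
pose u : 'rV[k]_n.+1 := \row_i v i.
have uw : eval_forms m u = w.
  apply/rowP => j; rewrite mxE; apply/eqP; rewrite -subr_eq0.
  have := vt (tnth m j - (w 0 j)%:MP); rewrite mevalB mevalC /meval_row.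
  rewrite (@meval_eq _ _ _ v) => [->//|i]; last by rewrite mxE.
  apply: ideal_gen_sub; apply/mapP; exists ('X_j - (w 0 j)%:MP).
    by apply: map_f; rewrite mem_enum.
  by rewrite comp_mpolyB comp_mpolyC comp_mpolyXU -tnth_nth.
have u0 : u != 0.
  apply: contraNneq (coords_neq0 p) => u0; rewrite -/w -uw u0; apply/eqP/rowP => j.
  rewrite !mxE -(scale0r (0 : 'rV[k]_n.+1)) (meval_row_homog _ _ (tnth_homog j)).
  by rewrite expr0n eqn0Ngt d_gt0 mul0r.
have -> : p = Defs.point (bpf u0).
  by apply: val_inj; rewrite val_coords /= uw.
exact: invariant_variety_point.
Qed.

(** Two forms that do not vanish on the image become nonzero polynomials after
    substitution, and so does their product. *)
Lemma invariant_variety_irreducible : zariski_irreducible X.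
Proof.
split.
  have v0 : const_mx 1 != 0 :> 'rV[k]_n.+1.
    by apply: (row_neq0 (i := ord0)); rewrite mxE oner_eq0.
  by exists (Defs.point (bpf v0)); apply: invariant_variety_point.
move=> _ _ [T Thom ->] [T' T'hom ->] cover.
apply: contrapT => /not_orP[nT nT'].
have miss (U : set S) : U `<=` @homogeneous k mu -> ~ X `<=` zero_locus U ->
    exists2 f, U f & f \mPo m != 0.
  move=> Uhom nU; apply: contrapT => nf; apply: nU => p Xp f Uf.
  apply: (vanishes_on_image (Uhom _ Uf)).2 Xp; apply/eqP; apply: contraT => f0.
  by case: nf; exists f.
have [f Tf f0] := miss T Thom nT; have [g T'g g0] := miss T' T'hom nT'.
have hom := homogeneousM (Thom _ Tf) (T'hom _ T'g).
have /negP := mulf_neq0 f0 g0; rewrite -rmorphM; apply; apply/eqP.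
apply/(vanishes_on_image hom) => p Xp v vp v0.
rewrite /meval_row mevalM; case: (cover p Xp) => [/(_ f Tf)|/(_ g T'g)] /(_ v vp v0).
  by rewrite /meval_row => ->; rewrite mul0r.
by rewrite /meval_row => ->; rewrite mulr0.
Qed.

(** A form that vanishes at the images of the points of the torus becomes zero
    after substitution, so the torus is dense in the image. *)
Lemma invariant_variety_toric : toric_variety X.
Proof.
split; first exact: (conj invariant_variety_closed invariant_variety_irreducible).
have ex_expo j : exists b, tnth m j = 'X_[b].
  by have /mP[b [bE _ _]] := mem_tnth j m; exists b.
have [a aE] := choice ex_expo.
have rowE v : \row_i ('X_[a i] : R).@[v] = eval_forms m (\row_i v i).
  by apply/rowP => j; rewrite !mxE aE; apply: meval_eq => i; rewrite mxE.
exists n.+1, a; apply/seteqP; split=> [p Xp Z [T Thom ->] sub f Tf|p]; last first.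
  apply; first exact: invariant_variety_closed.
  move=> q [v [v0 qE]]; have u0 : \row_i v i != 0.
    by apply: (row_neq0 (i := ord0)); rewrite mxE v0.
  have -> : q = Defs.point (bpf u0) by apply: val_inj; rewrite qE rowE.
  exact: invariant_variety_point.
apply: (vanishes_on_image (Thom _ Tf)).2 Xp.
apply/eqP; apply: contraT => /torus_nonroot[v [v0]].
rewrite comp_eval_forms => /eqP; case.
apply/(vanishes_point (bpf (row_neq0 (v0 ord0))) (Thom _ Tf)).
apply: (sub _ _ f Tf); exists (v 0); split=> //=.
rewrite rowE; congr (<[eval_forms m _]>%VS); by apply/rowP => i; rewrite mxE.
Qed.

Lemma invariant_variety_aCM : arithmetically_CM X.
Proof.
have [X0 _] := invariant_variety_irreducible; exists X0.
pose A := homogeneous_coordinate_ring X0.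
apply: (@CM_quotient k n.+1 d mu alpha m d_gt0 mP _ (\pi_A : {rmorphism S -> A})).
- by move=> a; exists (repr a); apply: reprK.
move=> f; rewrite -vanishing_idealE -[f in f \in _]subr0.
have /= := Quotient.idealrBE (vanishing_idealr X0 : idealr S) f 0.
rewrite (_ : (f - 0 \in _) = (f - 0 \in vanishing_ideal X)) // => ->.
have pi0 : \pi_A 0 = 0 by exact: rmorph0.
by split=> [f0|/eqP f0]; [apply/eqP; apply: etrans f0 (esym pi0) | apply: etrans f0 pi0].
Qed.

End Image.

Theorem theorem3p3 (k : closedFieldType) (n d mu : nat)
    (alpha : 'I_n.+1 -> nat) (e : k) (m : mu.-tuple {mpoly k[n.+1]})
    (char0 : [pchar k] =i pred0)
    (n_ge2 : (2 <= n)%N) (n_lt_d : (n < d)%N)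
    (alpha_mono : forall i j : 'I_n.+1, (i <= j)%N -> (alpha i <= alpha j)%N)
    (alpha_lt : forall i, (alpha i < d)%N)
    (alpha_gcd : gcdn (\big[gcdn/0%N]_(i < n.+1) alpha i) d = 1%N)
    (he : d.-primitive_root e)
    (hm : lists_invariant_monomials d (diag_group alpha e) m) :
  toric_variety (invariant_variety he hm) /\
  arithmetically_CM (invariant_variety he hm).
Proof.
by split; [exact: invariant_variety_toric | exact: invariant_variety_aCM].
Qed.
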